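(* Let $(\theta_n)$ be a nonincreasing null sequence in $(0,1)$, let $0<\xi<\omega_1$, and let $(\beta_n)$ be countable ordinals with $0<\beta_n<\omega^\xi$ for all $n$ and $\sup_n\beta_n=\omega^\xi$. Define all Schreier families using the standard choices. If condition $(\dagger)$ fails, then $I(T[(\theta_n,\mathcal{S}_{\beta_n})_{n=1}^\infty])=\omega^{\omega^\xi}$. In particular, $T[(\theta_n,\mathcal{S}_{\beta_n})_{n=1}^\infty]$ does not contain any $\ell^1$-$\mathcal{S}_{\omega^\xi}$-spreading model.
   Context: Schreier families: $\mathcal{S}_0=\{\{n\}\}\cup\{\emptyset\}$, $\mathcal{S}_1=\{F:|F|\le\min F\}$, $\mathcal{S}_{\beta+1}=\mathcal{S}_1[\mathcal{S}_\beta]$, and for limit $\beta$, $\mathcal{S}_\beta=\{F:F\in\mathcal{S}_{\hat\beta_n}\text{ for some }n\le\min F\}$ for a sequence $\hat\beta_n\uparrow\beta$; $\mathcal{M}[\mathcal{N}]$ is the set of unions $\bigcup F_i$ with $F_i\in\mathcal{N}$, $F_1<\dots<F_k$ ($\max F_i<\min F_{i+1}$) and $\{\min F_i\}\in\mathcal{M}$. Standard choices: for every countable limit ordinal a sequence strictly increasing to it is fixed; for a limit ordinal $\beta=\omega^{\beta_1}m_1+\dots+\omega^{\beta_k}m_k$ (Cantor normal form), $\mathcal{S}_\beta$ is defined using $\hat\beta_n=\omega^{\beta_1}m_1+\dots+\omega^{\beta_k}(m_k-1)+\omega^{\beta_k-1}n$ if $\beta_k$ is a successor, and $\hat\beta_n=\omega^{\beta_1}m_1+\dots+\omega^{\beta_k}(m_k-1)+\omega^{\zeta_n}$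 if $\beta_k$ is a limit, where $(\zeta_n)$ is the fixed sequence increasing to $\beta_k$. $T[(\theta_n,\mathcal{F}_n)]$ is the completion of $c_{00}$ under $\|x\|=\max\{\|x\|_{c_0},\sup_n\sup\theta_n\sum_i\|E_ix\|\}$ over $\mathcal{F}_n$-admissible $(E_i)$ (i.e. $E_1<\dots<E_k$, $\{\min E_i\}\in\mathcal{F}_n$). $\gamma(\varepsilon,m)=\max\{\beta_{n_s}+\dots+\beta_{n_1}:\varepsilon\theta_{n_s}\cdots\theta_{n_1}>\theta_m\}$ ($\max\emptyset=0$); condition $(\dagger)$: there exists $\varepsilon>0$ such that for every $\beta<\omega^\xi$ there is $m$ with $\gamma(\varepsilon,m)+2+\beta<\beta_m$. Bourgain $\ell^1$-index: for a Banach space $Y$ and $K\ge1$, $T(Y,K)$ is the tree of finite sequences $(x_1,\dots,x_n)$ of norm-one vectors with $\|\sum a_ix_i\|\ge K^{-1}\sum|a_i|$ for all scalars; derived trees $T^{(0)}=T$, $T^{(\beta+1)}=\{s\in T^{(\beta)}:(s,x)\in T^{(\beta)}\text{ for some }x\}$, intersections at limits; $I(Y,K)$ is the least $\beta$ with $T(Y,K)^{(\beta)}=\emptyset$, $I(Y)=\sup_KI(Y,K)$. A normalized sequence $(x_n)$ is an $\ell^1$-$\mathcal{F}$-spreading model if for some $K$, $\|\sum_{n\in F}a_nx_n\|\ge K^{-1}\sum_{n\in F}|a_n|$ for all $F\in\mathcal{F}$ and all scalars. *)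

(* Defs.v *)
From HB Require Import structures.
From mathcomp Require Import all_boot all_order all_algebra.
From mathcomp Require Import all_classical all_reals.
Set Implicit Arguments. Unset Strict Implicit. Unset Printing Implicit Defensive.
Import Order.TTheory GRing.Theory Num.Theory.
Local Open Scope ring_scope.

(* Countable ordinals as Brouwer trees: OZ = 0, OS a = a+1, OL f = sup_n f n. *)
(* Every Brouwer tree denotes a countable ordinal and every countable ordinal *)
(* is denoted by one; ordinal equality is [oeq].                             *)
Inductive Ord : Type := OZ | OS (a : Ord) | OL (f : nat -> Ord).

Inductive ole : Ord -> Ord -> Prop :=
| ole_zero b : ole OZ b
| ole_succ a b : ole a b -> ole (OS a) (OS b)
| ole_succ_r a b : ole a b -> ole a (OS b)
| ole_lim_l f b : (forall n, ole (f n) b) -> ole (OL f) b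
| ole_lim_r a f n : ole a (f n) -> ole a (OL f).

Definition olt (a b : Ord) : Prop := ole (OS a) b.
Definition oeq (a b : Ord) : Prop := ole a b /\ ole b a.

Fixpoint onat (n : nat) : Ord := if n is k.+1 then OS (onat k) else OZ.

Fixpoint oadd (a b : Ord) : Ord :=
  match b with OZ => a | OS b' => OS (oadd a b') | OL f => OL (fun n => oadd a (f n)) end.
Fixpoint omul (a b : Ord) : Ord :=
  match b with OZ => OZ | OS b' => oadd (omul a b') a | OL f => OL (fun n => omul a (f n)) end.
Fixpoint oexp (b : Ord) : Ord :=
  match b with
  | OZ => OS OZ
  | OS b' => OL (fun n => omul (oexp b') (onat n))
  | OL f => OL (fun n => oexp (f n))
  end.

Definition is_limit (a : Ord) : Prop :=
  olt OZ a /\ forall b, olt b a -> olt (OS b) a.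

(* "For every countable limit ordinal a sequence strictly increasing to it is
   fixed": fs a is that sequence (indexed n = 1, 2, ...; the value at 0 is
   irrelevant), depending only on the ordinal (not on the tree).            *)
Definition fund_seq (fs : Ord -> nat -> Ord) : Prop :=
  (forall a, is_limit a ->
     (forall n, olt (fs a n) (fs a n.+1)) /\ oeq (OL (fs a)) a) /\
  (forall a b, is_limit a -> oeq a b -> forall n, oeq (fs a n) (fs b n)).

(* Schreier families. Finite subsets of N = {1,2,...} are strictly increasing *)
(* lists of positive naturals; min F = head 0 F.                             *)
Definition fin (F : seq nat) : bool := sorted ltn F && all (fun n => 0 < n)%N F.
Definition fam := seq nat -> Prop.

Definition S0 : fam := fun F => F = [::] \/ exists n, (0 < n)%N /\ F = [:: n].
Definition S1 : fam := fun F => fin F /\ (size F <= head 0%N F)%N.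

Definition successive (Es : seq (seq nat)) : Prop :=
  all (fun E => (E != [::]) && fin E) Es /\
  sorted (fun A B => last 0%N A < head 0%N B)%N Es.

Definition conv (M N : fam) : fam := fun F =>
  exists Fs : seq (seq nat),
    [/\ successive Fs, (forall A, A \in Fs -> N A), F = flatten Fs
      & M (map (head 0%N) Fs)].

(* S : Ord -> fam is the system of Schreier families defined with the standard
   choices (fs being the fixed fundamental sequences).  For a limit beta whose
   Cantor normal form ends with omega^(g) we write beta = d + omega^g with
   d a multiple of omega^g (d = omega^{b1} m1 + ... + omega^{g}(mk - 1)).   *)
Definition schreier_system (fs : Ord -> nat -> Ord) (S : Ord -> fam) : Prop :=
  [/\ (forall a b, oeq a b -> forall F, S a F <-> S b F),
      (forall F, S OZ F <-> S0 F),
      (forall a F, S (OS a) F <-> conv S1 (S a) F),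
      (forall b d g' e, oeq b (oadd d (oexp (OS g'))) ->
         oeq d (omul (oexp (OS g')) e) ->
         forall F, S b F <-> (F = [::] \/ (F <> [::] /\
           exists n, (1 <= n <= head 0%N F)%N /\
                     S (oadd d (omul (oexp g') (onat n))) F)))
    &
      (forall b d g e, is_limit g -> oeq b (oadd d (oexp g)) ->
         oeq d (omul (oexp g) e) ->
         forall F, S b F <-> (F = [::] \/ (F <> [::] /\
           exists n, (1 <= n <= head 0%N F)%N /\
                     S (oadd d (oexp (fs g n))) F)))].

Section Tsirelson.
Variable R : realType.
Notation vec := (nat -> R).

Definition restr (E : seq nat) (x : vec) : vec := fun i => if i \in E then x i else 0.
Definition trunc (N : nat) (x : vec) : vec := fun i => if (0 < i <= N)%N then x i else 0.

Definition admissible (F : fam) (Es : seq (seq nat)) : Prop :=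
  successive Es /\ F (map (head 0%N) Es).

Definition norm0 (x : vec) : R := sup (range (fun i => `|x i|)).

(* the standard increasing approximation of the implicitly defined norm *)
Fixpoint normit (theta : nat -> R) (Fn : nat -> fam) (m : nat) (x : vec) : R :=
  if m is m'.+1 then
    Num.max (norm0 x)
      (sup [set r | exists n Es, admissible (Fn n) Es /\
                      r = theta n * \sum_(E <- Es) normit theta Fn m' (restr E x)])
  else norm0 x.

(* norm on c00 (finitely supported vectors on {1,2,...}) *)
Definition tnorm theta Fn (x : vec) : R := sup (range (fun m => normit theta Fn m x)).

(* elements of the completion: coefficient sequences whose expansion converges *)
Definition inT theta Fn (x : vec) : Prop :=
  x 0%N = 0 /\
  forall e : R, 0 < e -> exists N, forall p q, (N <= p <= q)%N ->
    tnorm theta Fn (fun i => trunc q x i - trunc p x i) < e.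

Definition Tnorm theta Fn (x : vec) : R := sup (range (fun N => tnorm theta Fn (trunc N x))).

Definition lincomb (a : nat -> R) (s : seq vec) : vec :=
  fun j => \sum_(i < size s) a i * nth (fun _ => 0) s i j.

Definition l1tree theta Fn (K : R) (s : seq vec) : Prop :=
  (forall i, (i < size s)%N ->
     inT theta Fn (nth (fun _ => 0) s i) /\ Tnorm theta Fn (nth (fun _ => 0) s i) = 1) /\
  forall a : nat -> R,
    K^-1 * \sum_(i < size s) `|a i| <= Tnorm theta Fn (lincomb a s).

Definition derive (T : seq vec -> Prop) : seq vec -> Prop :=
  fun s => T s /\ exists x, T (rcons s x).

Fixpoint dtree (T : seq vec -> Prop) (a : Ord) : seq vec -> Prop :=
  match a with
  | OZ => T
  | OS b => derive (dtree T b)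
  | OL f => fun s => forall n, dtree T (f n) s
  end.

Definition tree_empty (T : seq vec -> Prop) : Prop := forall s, ~ T s.

Definition indexK_is theta Fn (K : R) (a : Ord) : Prop :=
  tree_empty (dtree (l1tree theta Fn K) a) /\
  forall b, olt b a -> ~ tree_empty (dtree (l1tree theta Fn K) b).

Definition index_is theta Fn (a : Ord) : Prop :=
  (forall K : R, 1 <= K -> exists c, indexK_is theta Fn K c /\ ole c a) /\
  (forall b, olt b a -> exists K : R, 1 <= K /\ exists c, indexK_is theta Fn K c /\ olt b c).

(* (x_n)_{n>=1} is an l^1-F-spreading model (coordinate 0 unused) *)
Definition l1_spreading theta Fn (F : fam) (x : nat -> vec) : Prop :=
  (forall n, inT theta Fn (x n) /\ Tnorm theta Fn (x n) = 1) /\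
  exists K : R, 0 < K /\ forall (G : seq nat) (a : nat -> R), F G ->
    K^-1 * \sum_(n <- G) `|a n| <=
      Tnorm theta Fn (fun j => \sum_(n <- G) a n * x n j).

Fixpoint osum (beta : nat -> Ord) (l : seq nat) : Ord :=
  if l is n :: l' then oadd (osum beta l') (beta n) else OZ.

Definition gamma_cond (theta : nat -> R) (eps : R) (m : nat) (l : seq nat) : Prop :=
  l <> [::] /\ theta m < eps * \prod_(n <- l) theta n.

Definition gamma_is theta (beta : nat -> Ord) (eps : R) (m : nat) (g : Ord) : Prop :=
  (exists l, gamma_cond theta eps m l /\ oeq g (osum beta l) /\
     forall l', gamma_cond theta eps m l' -> ole (osum beta l') g) \/
  ((forall l, ~ gamma_cond theta eps m l) /\ oeq g OZ).

Definition dagger theta (beta : nat -> Ord) (xi : Ord) : Prop :=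
  exists eps : R, 0 < eps /\ forall b, olt b (oexp xi) ->
    exists m g, gamma_is theta beta eps m g /\
      olt (oadd (oadd g (onat 2)) b) (beta m).

End Tsirelson.

(* Main.v *)
Require Import Defs.
From HB Require Import structures.
From mathcomp Require Import all_boot all_order all_algebra.
From mathcomp Require Import all_classical all_reals.
From mathcomp Require Import ring lra.
Set Implicit Arguments. Unset Strict Implicit. Unset Printing Implicit Defensive.
Import Order.TTheory GRing.Theory Num.Theory.

(* If (dagger) fails for [e], there is [delta < omega^xi] such that every
   S_{beta_m}-admissible sequence of sets with large minima splits into S_delta-many
   groups, on each of which [theta m * sum] is at most [e] times the norm, or the group is
   a single set.  This rests on S_{a+b} being contained in S_b[S_a], which holds for the
   standard choices even when terms of [a] are absorbed in [a + b].

   Let [y] be a convex combination of widely separated blocks of norm at most [B <= 1] such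
   that sets of S_delta meet blocks of small total weight only.  Outside these blocks, and
   outside the few blocks starting before the threshold of [m], a block meets one group
   only; hence the norm of [y] is at most [max e (theta 0 * B)] up to a small error.
   Such combinations exist along every branch of an l1-tree whose derivative of order
   omega^(g + delta + 1) is nonempty, when derivatives of order omega^g provide the blocks.
   Finitely many iterations, of total order below omega^(omega^xi), produce l1-normalized
   combinations of branches with norm less than [1 / K].

   Conversely the S_a-sets of a sequence form a tree of order at least omega^a, which for
   the unit vectors and [a = beta n] gives the lower bound for the index, and for
   [a = omega^xi] excludes spreading models. *)

(** * Ordinal arithmetic on Brouwer trees *)

Lemma ole_refl a : ole a a.
Proof.
elim: a => [|a IH|f IH]; [exact: ole_zero | exact: ole_succ|].
by apply: ole_lim_l => n; apply: ole_lim_r (IH n).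
Qed.

Lemma ole_lim_inv a b : ole a b -> forall f, a = OL f -> forall n, ole (f n) b.
Proof.
elim=> [//|//|c d _ IH f E n|g c _ _ f [<-] //|c g m _ IH f E n].
- by apply: ole_succ_r; apply: IH.
- by apply: ole_lim_r (IH _ E n).
Qed.

Lemma ole_succ_inv a b : ole a b -> forall c, a = OS c ->
  (exists2 d, b = OS d & ole c d \/ ole a d) \/ (exists f n, b = OL f /\ ole a (f n)).
Proof.
case=> [//|c d H e [<-]|c d H e _|//|c g m H e _].
- by left; exists d => //; left.
- by left; exists d => //; right.
- by right; exists g, m.
Qed.

(** The second derivation may end with any number of right successor or limit steps, so each
    successor case runs an inner induction on [c] until a step facing the left one is reached. *)
Lemma ole_trans a b c : ole a b -> ole b c -> ole a c.
Proof.
move=> H; elim: H c => [b0 c _|a0 b0 _ IH c|a0 b0 _ IH c|f b0 _ IH c H|a0 f n _ IH c H].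
- exact: ole_zero.
- elim: c => [|c IHc|f IHf] /ole_succ_inv/(_ _ erefl)[[d E H]|[g [n [E H]]]] //.
  + case: E H => <- [/IH H|/IHc H]; [exact: ole_succ|exact: ole_succ_r].
  + by case: E H => <- /IHf H; apply: ole_lim_r H.
- elim: c => [|c IHc|f IHf] /ole_succ_inv/(_ _ erefl)[[d E H]|[g [n [E H]]]] //.
  + by case: E H => <- [/IH H|/IHc H]; apply: ole_succ_r.
  + by case: E H => <- /IHf H; apply: ole_lim_r H.
- by apply: ole_lim_l => n; apply: IH.
- by apply: IH; apply: (ole_lim_inv H).
Qed.

Lemma ole_succ_self a : ole a (OS a).
Proof. exact: ole_succ_r (ole_refl a). Qed.

Lemma olt_le a b : olt a b -> ole a b.
Proof. exact: ole_trans (ole_succ_self a). Qed.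

Lemma ole_SS a b : ole (OS a) (OS b) -> ole a b.
Proof.
move=> /ole_succ_inv/(_ _ erefl)[[d [<-] [//|/olt_le//]]|[f [n [//]]]].
Qed.

Lemma olt_lim_inv a f : olt a (OL f) -> exists n, olt a (f n).
Proof.
by move=> /ole_succ_inv/(_ _ erefl)[[d //]|[g [n [[<-] H]]]]; exists n.
Qed.

Lemma olt_zero a : ~ olt a OZ.
Proof. by move=> /ole_succ_inv/(_ _ erefl)[[d //]|[g [n []]]]. Qed.

Lemma ole_olt_trans a b c : ole a b -> olt b c -> olt a c.
Proof. by move=> H; apply: ole_trans; apply: ole_succ. Qed.

Lemma olt_ole_trans a b c : olt a b -> ole b c -> olt a c.
Proof. exact: ole_trans. Qed.

Lemma olt_S a : olt a (OS a). Proof. exact: ole_refl. Qed.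

Lemma ole_lim f n : ole (f n) (OL f).
Proof. exact: ole_lim_r (ole_refl _). Qed.

(** Different trees may denote the same ordinal, so accessibility is proved for all [b] with
    [ole b a] by induction on the tree [a]; what lies strictly below a limit tree lies below one of
    its branches. *)
Lemma olt_wf : well_founded olt.
Proof.
suff H a : forall b, ole b a -> Acc olt b by move=> a; apply: H (ole_refl a).
elim: a => [|a IH|f IH] b Hb; constructor=> c Hc; have := olt_ole_trans Hc Hb.
- by move/olt_zero.
- by move/ole_SS; apply: IH.
- by move/olt_lim_inv => [n /olt_le]; apply: IH.
Qed.

Lemma olt_irr a : ~ olt a a.
Proof. by elim/(well_founded_ind olt_wf): a => a IH H; apply: (IH a). Qed.

Lemma ole_or_olt a b : ole a b \/ olt b a.
Proof.
elim: a b => [|a IH|f IH] b; first by left; exact: ole_zero.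
- elim: b => [|b _|g IHg].
  + by right; apply: ole_succ; exact: ole_zero.
  + by case: (IH b) => H; [left|right]; apply: ole_succ.
  + case: (pselect (exists n, ole (OS a) (g n))) => [[n H]|H].
      by left; apply: ole_lim_r H.
    right; apply: ole_succ; apply: ole_lim_l => n.
    by case: (IHg n) => [Hn|/ole_SS //]; case: H; exists n.
- case: (pselect (forall n, ole (f n) b)) => [H|/existsNP[n H]].
    by left; apply: ole_lim_l.
  by right; case: (IH n b) => // Hn; apply: ole_lim_r Hn.
Qed.

Lemma not_olt a b : ~ olt a b -> ole b a.
Proof. by case: (ole_or_olt b a). Qed.

Lemma not_ole a b : ~ ole a b -> olt b a.
Proof. by case: (ole_or_olt a b). Qed.

Lemma ole_ltP a b : (forall c, olt c a -> olt c b) -> ole a b.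
Proof. by move=> H; case: (ole_or_olt a b) => // /H /olt_irr. Qed.

Lemma olt_ind (P : Ord -> Prop) :
  (forall a, (forall b, olt b a -> P b) -> P a) -> forall a, P a.
Proof. exact: well_founded_ind olt_wf P. Qed.

Lemma ord_least (P : Ord -> Prop) a : P a ->
  exists2 c, P c & forall b, olt b c -> ~ P b.
Proof.
elim/olt_ind: a => a IH Pa.
case: (pselect (exists2 b, olt b a & P b)) => [[b Hb Pb]|H]; first exact: IH Pb.
by exists a => // b Hb Pb; apply: H; exists b.
Qed.

Lemma oeq_refl a : oeq a a. Proof. by split; exact: ole_refl. Qed.
Lemma oeq_sym a b : oeq a b -> oeq b a. Proof. by case. Qed.
Lemma oeq_trans a b c : oeq a b -> oeq b c -> oeq a c.
Proof. by move=> [ab ba] [bc cb]; split; [exact: ole_trans bc|exact: ole_trans ba]. Qed.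

Lemma ord_cases a : [\/ oeq a OZ, exists b, oeq a (OS b) | is_limit a].
Proof.
case: (ole_or_olt a OZ) => [H|a0]; first by apply: Or31; split=> //; exact: ole_zero.
case: (pselect (exists2 b, olt b a & ole a (OS b))) => [[b Hb Hab]|H].
  by apply: Or32; exists b.
apply: Or33; split=> // b Hb; case: (ole_or_olt a (OS b)) => // H'.
by case: H; exists b.
Qed.

Lemma oeq_zero a : ole a OZ -> oeq a OZ.
Proof. by split=> //; exact: ole_zero. Qed.

Lemma oadd0l a : oadd OZ a = a.
Proof. by elim: a => //= [a ->//|f IH]; congr OL; apply: funext. Qed.

Lemma oaddA a b c : oadd (oadd a b) c = oadd a (oadd b c).
Proof. by elim: c => //= [c ->//|f IH]; congr OL; apply: funext. Qed.

Lemma oadd_lel a b c : ole b c -> ole (oadd a b) (oadd a c).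
Proof.
elim=> [d|d e _ IH|d e _ IH|f d _ IH|d f n _ IH] /=.
- elim: d => [|d IH|f IH] /=; [exact: ole_refl|exact: ole_succ_r|].
  exact: ole_lim_r (IH 0).
- exact: ole_succ.
- exact: ole_succ_r.
- exact: ole_lim_l.
- exact: ole_lim_r IH.
Qed.

Lemma oadd_lt a b c : olt b c -> olt (oadd a b) (oadd a c).
Proof. by move/(@oadd_lel a). Qed.

Lemma oadd_ler a b c : ole a b -> ole (oadd a c) (oadd b c).
Proof.
move=> H; elim: c => [//|c IH|f IH] /=; first exact: ole_succ.
by apply: ole_lim_l => n; apply: ole_lim_r (IH n).
Qed.

Lemma oadd_le_self a b : ole a (oadd a b).
Proof. exact: (@oadd_lel a OZ b (ole_zero b)). Qed.

Lemma oadd_le_selfr a b : ole b (oadd a b).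
Proof. by have := @oadd_ler OZ a b (ole_zero a); rewrite oadd0l. Qed.

Lemma oadd_le a b c d : ole a b -> ole c d -> ole (oadd a c) (oadd b d).
Proof. by move=> H1 H2; apply: ole_trans (oadd_ler _ H1) (oadd_lel _ H2). Qed.

Lemma oadd_eq a b c d : oeq a b -> oeq c d -> oeq (oadd a c) (oadd b d).
Proof. by move=> [? ?] [? ?]; split; exact: oadd_le. Qed.

(** The difference is the least [c] with [b <= a + c]. At a limit tree, a branch strictly below it
    fails this inequality by minimality, and a branch denoting the same ordinal falls under the
    induction hypothesis. *)
Lemma oadd_sub a b : ole a b -> exists c, oeq b (oadd a c).
Proof.
move=> ab; have [|c bc cmin] := @ord_least (fun c => ole b (oadd a c)) b.
  exact: oadd_le_selfr.
exists c; split=> //; elim: c bc cmin => [//|c _|f H] /= bc cmin.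
  by apply: not_ole; apply: cmin; exact: olt_S.
apply: ole_lim_l => n; case: (ole_or_olt (OL f) (f n)) => [Hf|/cmin]; last first.
  by move/not_ole/olt_le.
apply: H => [|d Hd]; first exact: ole_trans bc (oadd_lel a Hf).
exact: cmin (olt_ole_trans Hd (ole_lim f n)).
Qed.

Lemma oadd_ltP a b c : olt c (oadd a b) -> olt c a \/ exists2 d, olt d b & oeq c (oadd a d).
Proof.
move=> H; case: (ole_or_olt a c) => [/oadd_sub[d e]|]; [right|by left].
exists d => //; case: (ole_or_olt b d) => // /(oadd_lel a) H'.
by case: (olt_irr (olt_ole_trans H (ole_trans H' e.2))).
Qed.

Lemma onatD m n : onat (m + n) = oadd (onat m) (onat n).
Proof. by elim: n => [|n /= <-]; rewrite ?addn0 ?addnS. Qed.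

Lemma omul1 a : omul a (onat 1) = a.
Proof. exact: oadd0l. Qed.

Lemma omulD a b c : omul a (oadd b c) = oadd (omul a b) (omul a c).
Proof.
by elim: c => //= [c ->|f IH]; [rewrite oaddA|congr OL; apply: funext].
Qed.

Lemma omulA a b c : omul (omul a b) c = omul a (omul b c).
Proof.
by elim: c => //= [c ->|f IH]; [rewrite omulD|congr OL; apply: funext].
Qed.

Lemma omul_lel a b c : ole b c -> ole (omul a b) (omul a c).
Proof.
elim=> [d|d e _ IH|d e _ IH|f d _ IH|d f n _ IH] /=.
- exact: ole_zero.
- exact: oadd_ler.
- exact: ole_trans IH (oadd_le_self _ _).
- exact: ole_lim_l.
- exact: ole_lim_r IH.
Qed.

Lemma omul_ler a b c : ole a b -> ole (omul a c) (omul b c).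
Proof.
move=> H; elim: c => [|c IH|f IH] /=; [exact: ole_zero|exact: oadd_le|].
by apply: ole_lim_l => n; apply: ole_lim_r (IH n).
Qed.

Lemma omul_eq a b c d : oeq a b -> oeq c d -> oeq (omul a c) (omul b d).
Proof.
move=> [ab ba] [cd dc]; split.
- exact: ole_trans (omul_ler _ ab) (omul_lel _ cd).
- exact: ole_trans (omul_ler _ ba) (omul_lel _ dc).
Qed.

Lemma oexp_gt0 a : olt OZ (oexp a).
Proof.
elim: a => [|a IH|f IH] /=; first exact: ole_refl.
  by apply: (@ole_lim_r _ _ 1); rewrite omul1.
exact: (@ole_lim_r _ _ 0 (IH 0)).
Qed.

Lemma ole_oexpS_mul a n : ole (omul (oexp a) (onat n)) (oexp (OS a)).
Proof. exact: (@ole_lim (fun n => omul (oexp a) (onat n)) n). Qed.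

Lemma oexp_leS a : ole (oexp a) (oexp (OS a)).
Proof. by have := ole_oexpS_mul a 1; rewrite omul1. Qed.

Lemma oexp_le a b : ole a b -> ole (oexp a) (oexp b).
Proof.
elim=> [d|d e _ IH|d e _ IH|f d _ IH|d f n _ IH].
- exact: oexp_gt0.
- by apply: ole_lim_l => n; apply: ole_lim_r (omul_ler _ IH).
- exact: ole_trans IH (oexp_leS e).
- exact: ole_lim_l.
- exact: ole_lim_r IH.
Qed.

Lemma oexp_eq a b : oeq a b -> oeq (oexp a) (oexp b).
Proof. by move=> [? ?]; split; exact: oexp_le. Qed.

Lemma oexp_ltS a : olt (oexp a) (oexp (OS a)).
Proof.
apply: ole_trans (ole_oexpS_mul a 2); rewrite /= oadd0l.
exact: (@oadd_lt (oexp a) OZ _ (oexp_gt0 a)).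
Qed.

Lemma oexp_lt a b : olt a b -> olt (oexp a) (oexp b).
Proof. by move/oexp_le; apply: ole_trans; exact: oexp_ltS. Qed.

Lemma oexp_ltI a b : olt (oexp a) (oexp b) -> olt a b.
Proof. by move=> H; apply: not_ole => /oexp_le H'; case: (olt_irr (olt_ole_trans H H')). Qed.

Lemma ole_oexp a : ole a (oexp a).
Proof.
elim: a => [|a IH|f IH]; [exact: ole_zero| |].
  exact: ole_olt_trans IH (oexp_ltS a).
by apply: ole_lim_l => n; apply: ole_lim_r (IH n).
Qed.

Lemma oexpD a b : oexp (oadd a b) = omul (oexp a) (oexp b).
Proof.
elim: b => [|b IH|f IH] /=; first by rewrite oadd0l.
- by congr OL; apply: funext => n; rewrite IH omulA.
- by congr OL; apply: funext.
Qed.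

(** Additive indecomposability: ordinals below [omega^g n] and [omega^g m] have their sum below
    [omega^g (n + m)]; at a limit both lie below the larger of two powers. *)
Lemma oexp_add_closed g a b : olt a (oexp g) -> olt b (oexp g) -> olt (oadd a b) (oexp g).
Proof.
elim: g => [|g _|f IH] /=.
- by move=> Ha /ole_SS Hb; exact: ole_olt_trans (oadd_lel a Hb) Ha.
- move=> /olt_lim_inv[n Hn] /olt_lim_inv[m Hm]; apply: (@ole_lim_r _ _ (n + m)).
  by rewrite onatD omulD; exact: ole_olt_trans (oadd_ler b (olt_le Hn)) (oadd_lt _ Hm).
- move=> /olt_lim_inv[n Hn] /olt_lim_inv[m Hm].
  case: (ole_or_olt (f n) (f m)) => [|/olt_le] /oexp_le H.
    by apply: (@ole_lim_r _ _ m); apply: IH => //; exact: olt_ole_trans H.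
  by apply: (@ole_lim_r _ _ n); apply: IH => //; exact: olt_ole_trans H.
Qed.

Lemma oexp_absorb g a : olt a (oexp g) -> oeq (oadd a (oexp g)) (oexp g).
Proof.
move=> Ha; split; last exact: oadd_le_selfr.
apply: ole_ltP => c /oadd_ltP[Hc|[d Hd e]]; first exact: olt_ole_trans Hc (olt_le Ha).
by apply: ole_olt_trans e.1 _; exact: oexp_add_closed.
Qed.

Lemma oexp_limit g : olt OZ g -> is_limit (oexp g).
Proof.
move=> g0; split=> [|b Hb]; first exact: oexp_gt0.
apply: (@oexp_add_closed g b (onat 1)) => //=.
exact: oexp_lt g0.
Qed.

(** [q] is the predecessor of the least multiplier that carries the product beyond [a]; a limit tree
    in that place is replaced by one of its branches. *)
Lemma ord_div a g : exists q r, oeq a (oadd (omul (oexp g) q) r) /\ olt r (oexp g).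
Proof.
have [|q Hq qmin] := @ord_least (fun q => olt a (omul (oexp g) q)) (OS a).
  apply: (@ole_trans _ (omul (OS OZ) (OS a))); last exact: omul_ler (oexp_gt0 g).
  suff -> : forall b, omul (OS OZ) b = b by exact: ole_refl.
  by elim=> //= [b ->//|f IH]; congr OL; apply: funext.
elim: q Hq qmin => [/olt_zero//|q _|f IH] Hq qmin.
  have Hqa : ole (omul (oexp g) q) a by apply: not_olt; apply: qmin; exact: olt_S.
  have [r e] := oadd_sub Hqa; exists q, r; split=> //.
  case: (ole_or_olt (oexp g) r) => // /(oadd_lel (omul (oexp g) q)) H.
  by case: (olt_irr (olt_ole_trans Hq (ole_trans H e.2))).
move/olt_lim_inv: Hq => [n Hn]; apply: (IH n Hn) => b Hb.
by apply: qmin; exact: olt_ole_trans Hb (ole_lim f n).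
Qed.

Lemma omul_pos a e : olt OZ e -> exists e', oeq (omul a e) (oadd a (omul a e')).
Proof.
move=> /(@oadd_sub (onat 1))[e' He]; exists e'.
by rewrite -{2}(omul1 a) -omulD; apply: omul_eq => //; exact: oeq_refl.
Qed.

(* The remainder of [a] modulo omega^g is absorbed by the first omega^g. *)
Lemma oadd_multiple a g e : olt OZ e ->
  exists e', oeq (oadd a (omul (oexp g) e)) (omul (oexp g) e').
Proof.
move=> e0; have [q [r [Ha Hr]]] := ord_div a g; have [e' He'] := omul_pos (oexp g) e0.
exists (oadd q (oadd (onat 1) e')); rewrite !omulD omul1.
apply: oeq_trans (oadd_eq Ha He') _; rewrite oaddA -(oaddA r).
apply: oadd_eq (oeq_refl _) _; apply: oadd_eq (oeq_refl _); exact: oexp_absorb.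
Qed.

(* The least nonzero [r] with [a = d + r] is additively indecomposable, hence a power
   of omega: this is the last term of the Cantor normal form. *)
Lemma limit_last_term a : is_limit a ->
  exists d g e, [/\ oeq a (oadd d (oexp g)), oeq d (omul (oexp g) e) & olt OZ g].
Proof.
move=> la; have [|r [r0 [d ad]] rmin] :=
  @ord_least (fun r => olt OZ r /\ exists d, oeq a (oadd d r)) a.
  by split; [case: la|exists OZ; rewrite oadd0l; exact: oeq_refl].
have [|g' Hg' gmin] := @ord_least (fun g => olt r (oexp g)) (OS r).
  exact: ole_olt_trans (ole_oexp r) (oexp_ltS r).
have [g [Hgr Hg]] : exists g, ole (oexp g) r /\ olt r (oexp (OS g)).
  elim: g' Hg' gmin => [/ole_SS|g _|f IH] H gmin.
  - by case: (olt_zero (olt_ole_trans r0 H)).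
  - by exists g; split=> //; apply: not_olt; apply: gmin; exact: olt_S.
  - move/olt_lim_inv: H => [n Hn]; apply: (IH n Hn) => b Hb; apply: gmin.
    exact: olt_ole_trans Hb (ole_lim f n).
have rg : oeq r (oexp g).
  split=> //; case: (ole_or_olt r (oexp g)) => // gr.
  have [s rs] := oadd_sub Hgr.
  have s0 : olt OZ s.
    by apply: not_ole => /(oadd_lel (oexp g)) H; case: (olt_irr (olt_ole_trans gr (ole_trans rs.1 H))).
  have ads : oeq a (oadd (oadd d (oexp g)) s).
    by rewrite oaddA; apply: oeq_trans ad _; apply: oadd_eq (oeq_refl _) rs.
  have rles : ole r s by apply: not_olt => /rmin; apply; split=> //; eexists; exact: ads.
  (* otherwise r = omega^g + r, hence r >= omega^g n for all n *)
  have : forall n, ole (omul (oexp g) (onat n)) r.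
    elim=> [|n IH]; first exact: ole_zero.
    have -> : omul (oexp g) (onat n.+1) = oadd (oexp g) (omul (oexp g) (onat n)).
      by rewrite -add1n onatD omulD omul1.
    apply: ole_trans rs.2; apply: oadd_lel; exact: ole_trans rles.
  by move/ole_lim_l => H; case: (olt_irr (olt_ole_trans Hg H)).
(* The remainder of [d] modulo [omega^g] is absorbed by the last term, so [d] may be replaced by a
   multiple of [omega^g], the shape that the standard choices demand. *)
have [q [s [ds Hs]]] := ord_div d g.
(* Exponent 0 would make [a] the successor [d + 1]. *)
have g0 : olt OZ g.
  apply: not_ole => /oexp_le Hg0.
  have [b ab] : exists b, oeq a (OS b).
    exists d; apply: oeq_trans ad _; split; first exact: oadd_lel (ole_trans rg.1 Hg0).
    by apply: (@oadd_lt d OZ).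
  by have := la.2 b ab.2; move/(fun H => olt_ole_trans H ab.1)/olt_irr.
exists (omul (oexp g) q), g, q; split=> //; last exact: oeq_refl.
apply: oeq_trans ad _; apply: oeq_trans (oadd_eq ds rg) _; rewrite oaddA.
by apply: oadd_eq (oeq_refl _) _; exact: oexp_absorb.
Qed.

(** * Schreier families *)

Lemma fin_cons x F : fin (x :: F) = [&& (0 < x)%N, path ltn x F & fin F].
Proof.
rewrite /fin /=; case px: (path ltn x F); rewrite ?andbF //=.
by rewrite (path_sorted px) andbA.
Qed.

Lemma fin_cat x E F : fin ((x :: E) ++ F) =
  [&& fin (x :: E), fin F & if F is y :: _ then (last x E < y)%N else true].
Proof.
rewrite /fin /= cat_path all_cat; case: F => [|y F] /=; first by rewrite !andbT.
by do !case: (path _ _ _) => //=; do ?case: (all _ _) => //=; case: (_ < _)%N;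
   rewrite ?andbF ?andbT //; do ?case: (0 < _)%N.
Qed.

(** Replaces the order conditions between neighbours by sortedness of the concatenation, which is
    stable under regrouping. *)
Lemma successiveP Es :
  successive Es <-> all (fun E => E != [::]) Es && fin (flatten Es).
Proof.
suff H : all (fun E => (E != [::]) && fin E) Es &&
         sorted (fun A B => last 0%N A < head 0%N B)%N Es =
         all (fun E => E != [::]) Es && fin (flatten Es).
  by rewrite -H; split=> [[-> ->]|/andP].
elim: Es => [//|[//|x E] [|E' Es] IH] /=.
  by rewrite cats0 !andbT.
move: IH; rewrite -cat_cons fin_cat => IH.
case: E' IH => [|y E'] IH; first by rewrite /= andbF.
rewrite -[LHS]/(_ && _ && (_ && _)) andbACA IH.
rewrite /=; set a := all _ Es; case: a; rewrite /= ?andbF //.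
by case: (fin (x :: E)); case: (fin (y :: _)); rewrite ?andbF ?andbT.
Qed.

Lemma successive_cons E Es : successive (E :: Es) -> successive Es.
Proof.
move=> /successiveP /andP[/= /andP[E0 H1]]; case: E E0 => [//|x E] _.
by rewrite fin_cat => /and3P[_ H2 _]; apply/successiveP/andP.
Qed.

Lemma fin_catE E F : fin (E ++ F) = [&& allrel ltn E F, fin E & fin F].
Proof.
rewrite /fin !(sorted_pairwise ltn_trans) pairwise_cat all_cat.
by case: (allrel _ _ _) => //=; do !case: (pairwise _ _) => //=; rewrite ?andbF.
Qed.

Lemma successive_cat Es Es' : successive (Es ++ Es') -> successive Es /\ successive Es'.
Proof.
move=> /successiveP; rewrite all_cat flatten_cat fin_catE.
by move=> /andP[/andP[? ?] /and3P[_ ? ?]]; split; apply/successiveP/andP.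
Qed.

Lemma head_le F x : fin F -> x \in F -> (head 0%N F <= x)%N.
Proof.
case: F => [//|y F] /=; rewrite fin_cons => /and3P[_ p _].
by rewrite inE => /predU1P[->//|/(allP (order_path_min ltn_trans p))/ltnW].
Qed.

Lemma fin_gt0 F x : fin F -> x \in F -> (0 < x)%N.
Proof. by move=> /andP[_ /allP]; apply. Qed.

Lemma fin_heads Es : successive Es -> fin (map (head 0%N) Es).
Proof.
elim: Es => [//|E Es IH] sE; have fE := IH (successive_cons sE).
rewrite (_ : map _ _ = [:: head 0%N E] ++ map (head 0%N) Es) // fin_catE fE andbT.
move/successiveP: sE => /andP[/= /andP[E0 aE]]; rewrite fin_catE => /and3P[/allrelP r fE' _].
have hE : head 0%N E \in E by case: (E) E0 => //= *; rewrite inE eqxx.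
apply/andP; split; last by rewrite /fin /= (fin_gt0 fE' hE).
apply/allrelP => x y; rewrite inE => /eqP -> /mapP[E' E'i ->]; apply: r => //.
apply/flattenP; exists E' => //; move/allP: aE => /(_ _ E'i).
by case: (E') => //= *; rewrite inE eqxx.
Qed.

(** Each outer set is cut into its own pieces. The first piece keeps the minimum, so the condition
    [M] on the outer minima is unchanged. *)
Lemma convA M N P F : conv M (conv N P) F -> conv (conv M N) P F.
Proof.
move=> [Fs [sF cF -> mF]].
have /choice[G HG] A : exists Gs, A \in Fs ->
    [/\ successive Gs, (forall B, B \in Gs -> P B), A = flatten Gs & N (map (head 0%N) Gs)].
  by case: (pselect (A \in Fs)) => [/cF[Gs ?]|H]; [exists Gs|exists [::]].
move/successiveP: (sF) => /andP[aF fF].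
have eF : flatten (flatten (map G Fs)) = flatten Fs.
  elim: {sF cF mF aF fF} Fs HG => [//|A Fs IH] HG /=; rewrite flatten_cat IH; last first.
    by move=> B BF; apply: HG; rewrite inE BF orbT.
  by have [|_ _ <- _] := HG A; rewrite ?mem_head.
have sG : successive (flatten (map G Fs)).
  apply/successiveP; rewrite eF fF andbT; apply/allP=> E /flattenP[Gs /mapP[A AF ->] EG].
  by have [/successiveP/andP[/allP/(_ _ EG)]] := HG A AF.
have hA A : A \in Fs -> head 0%N (map (head 0%N) (G A)) = head 0%N A.
  move=> AF; have [/successiveP/andP[aG _] _ eA _] := HG A AF.
  by rewrite {2}eA; case: (G A) aG => [//|[//|]].
exists (flatten (map G Fs)); split=> //.
- by move=> B /flattenP[Gs /mapP[A AF ->] BG]; have [_ + _ _] := HG A AF; apply.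
exists (map (map (head 0%N)) (map G Fs)); split.
- apply/successiveP; rewrite -map_flatten (fin_heads sG) andbT -map_comp.
  apply/allP=> E /mapP[A AF ->] /=; rewrite -size_eq0 size_map size_eq0.
  have [_ _ eA _] := HG A AF; apply/eqP => E0.
  by move/allP: aF => /(_ _ AF); rewrite eA E0.
- by move=> B; rewrite -map_comp => /mapP[A AF ->] /=; have [] := HG A AF.
- by rewrite map_flatten.
- rewrite -!map_comp (@eq_in_map _ _ _ (head 0%N) Fs).1 // => A AF /=; exact: hA.
Qed.

Lemma conv_single (M N : fam) F :
  (forall n, (0 < n)%N -> M [:: n]) -> M [::] -> fin F -> N F -> conv M N F.
Proof.
move=> M1 M0 fF NF; case: F fF NF => [|x F] fF NF; first by exists [::].
exists [:: x :: F]; split=> //=; last by apply: M1; apply: (fin_gt0 fF); rewrite mem_head.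
- by apply/successiveP; rewrite /= cats0.
- by move=> A; rewrite inE => /eqP ->.
- by rewrite cats0.
Qed.

Section Schreier.
Variables (fs : Ord -> nat -> Ord) (S : Ord -> fam).
Hypotheses (Hfs : fund_seq fs) (HS : schreier_system fs S).

Lemma S_eq a b F : oeq a b -> S a F -> S b F.
Proof. by case: HS => H _ _ _ _ /H/(_ F)[]. Qed.

Lemma S_zero F : S OZ F <-> S0 F. Proof. by case: HS. Qed.
Lemma S_succ a F : S (OS a) F <-> conv S1 (S a) F. Proof. by case: HS. Qed.

(* [h] is the part of the chosen fundamental sequence below omega^g; the standard
   choice for d + omega^g, with d a multiple of omega^g, is d + h n. *)
Definition power_seq (g : Ord) (h : nat -> Ord) : Prop :=
  [/\ forall n, ole (h n) (h n.+1), forall n, olt (h n) (oexp g), ole (oexp g) (OL h)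
    & forall d e, oeq d (omul (oexp g) e) -> forall F,
        S (oadd d (oexp g)) F <-> (F = [::] \/ (F <> [::] /\
           exists n, (1 <= n <= head 0%N F)%N /\ S (oadd d (h n)) F))].

Lemma power_seq_exists g : olt OZ g -> exists h, power_seq g h.
Proof.
move=> g0; case: HS => _ _ _ Hs Hl; case: (ord_cases g) => [[H _]|[g' eg]|lg].
- by case: (olt_zero (olt_ole_trans g0 H)).
- have eg' := oexp_eq eg.
  exists (fun n => omul (oexp g') (onat n)); split.
  + by move=> n; exact: oadd_le_self.
  + move=> n; apply: olt_ole_trans eg'.2; apply: olt_ole_trans (ole_oexpS_mul g' n.+1).
    exact: (@oadd_lt _ OZ _ (oexp_gt0 g')).
  + exact: eg'.1.
  + move=> d e de; apply: (Hs _ _ _ e).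
      by apply: oadd_eq (oeq_refl _) _.
    by apply: oeq_trans de _; apply: omul_eq (oeq_refl _).
- case: (Hfs) => /(_ _ lg)[fsm [fs1 fs2]] _.
  exists (fun n => oexp (fs g n)); split.
  + by move=> n; apply: oexp_le; apply: olt_le.
  + move=> n; apply: oexp_lt; apply: olt_ole_trans (fsm n) _.
    exact: ole_trans (ole_lim _ _) fs1.
  + by apply: ole_trans (oexp_le fs2) _; exact: ole_refl.
  + by move=> d e de; apply: (Hl _ _ _ e) => //; exact: oeq_refl.
Qed.

Lemma S_limit a : is_limit a -> exists h : nat -> Ord,
  [/\ forall n, ole (h n) (h n.+1), forall n, olt (h n) a, ole a (OL h)
    & forall F, S a F <-> (F = [::] \/ (F <> [::] /\
           exists n, (1 <= n <= head 0%N F)%N /\ S (h n) F))].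
Proof.
move=> /limit_last_term[d [g [e [ad de g0]]]].
have [h [h1 h2 h3 h4]] := power_seq_exists g0.
exists (fun n => oadd d (h n)); split.
- by move=> n; apply: oadd_lel.
- by move=> n; apply: olt_ole_trans ad.2; apply: oadd_lt.
- by apply: ole_trans ad.1 _; exact: (oadd_lel d h3).
- move=> F; rewrite -(h4 d e) //.
  by split; apply: S_eq => //; exact: oeq_sym.
Qed.

(** Packages the recursion defining the families, hiding the Cantor normal form behind a monotone
    sequence [h] cofinal in the limit. Invariance under [oeq] is assumed because the cases are
    recognized only up to equality of ordinals. *)
Lemma S_ind (P : Ord -> Prop) :
  (forall a b, oeq a b -> P b -> P a) ->
  P OZ ->
  (forall a, P a -> P (OS a)) ->
  (forall a (h : nat -> Ord), is_limit a -> (forall n, ole (h n) (h n.+1)) ->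
     (forall n, olt (h n) a) -> ole a (OL h) ->
     (forall F, S a F <-> (F = [::] \/ (F <> [::] /\
        exists n, (1 <= n <= head 0%N F)%N /\ S (h n) F))) ->
     (forall b, olt b a -> P b) -> P a) ->
  forall a, P a.
Proof.
move=> Pe P0 PS PL; elim/olt_ind => a IH; case: (ord_cases a) => [H|[b e]|la].
- exact: Pe H P0.
- by apply: (Pe _ _ e); apply: PS; apply: IH; exact: e.2.
- by have [h [h1 h2 h3 h4]] := S_limit la; apply: (PL a h).
Qed.

Lemma S_nil a : S a [::].
Proof.
elim/S_ind: a => [a b e|||a h _ _ _ _ HF _].
- by apply: S_eq; exact: oeq_sym.
- by apply/S_zero; left.
- by move=> a _; apply/S_succ; exists [::]; split.
- by apply/HF; left.
Qed.

Lemma S_fin a F : S a F -> fin F.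
Proof.
move: F; elim/S_ind: a => [a b e H F /(S_eq e)/H//|||a h _ _ h2 _ HF IH].
- by move=> F /S_zero[->//|[n [n0 ->]]]; rewrite /fin /= n0.
- by move=> a IH F /S_succ[Fs [/successiveP/andP[_ ?] _ -> _]].
- by move=> F /HF[->//|[_ [n [_]]]]; apply: IH (h2 n) F.
Qed.

Lemma S_single a n : (0 < n)%N -> S a [:: n].
Proof.
move=> n0; elim/S_ind: a => [a b e|||a h _ _ h2 _ HF IH].
- by apply: S_eq; exact: oeq_sym.
- by apply/S_zero; right; exists n.
- move=> a H; apply/S_succ; exists [:: [:: n]]; split=> //.
  + by apply/successiveP; rewrite /= /fin /= n0.
  + by move=> A; rewrite inE => /eqP ->.
  + by rewrite /S1 /fin /= n0.
- by apply/HF; right; split=> //; exists 1%N; split=> //; exact: IH (h2 1%N).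
Qed.

(** Deleting the minimum shortens or removes the first block: the number of blocks does not grow and
    the minimum does not drop, so the [S1] condition and the index bound at limits persist. *)
Lemma S_behead a F : S a F -> S a (behead F).
Proof.
move: F; elim/S_ind: a => [a b e H F /(S_eq e)/H/(S_eq (oeq_sym e))//|||a h _ _ h2 _ HF IH].
- by move=> F /S_zero[->|[n [n0 ->]]]; apply/S_zero; left.
- move=> a IH F /S_succ[[|[|x E] Fs] [sF cF -> [fH hH]]]; try by [exact: S_nil|move/successiveP: sF].
  apply/S_succ; case: E => [|y E] in sF cF fH hH *.
    exists Fs; split=> //; first exact: successive_cons sF.
      by move=> A AF; apply: cF; rewrite inE AF orbT.
    rewrite /S1; move: fH hH => /=; case: (Fs) => [//|E' Fs'] /=.
    rewrite [fin (x :: _)]fin_cons => /and3P[_ /andP[xy _] fH] H; split=> //.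
    by apply: leq_trans (ltnW xy); exact: ltnW H.
  have xy : (x < y)%N.
    move/successiveP: sF => /andP[_] /=.
    by rewrite fin_cons => /and3P[_ /andP[]].
  have sF' : successive ((y :: E) :: Fs).
    apply/successiveP; move/successiveP: sF => /andP[/= -> /=].
    by rewrite fin_cons => /and3P[].
  exists ((y :: E) :: Fs); split=> //.
    move=> A; rewrite inE => /predU1P[->|AF]; last by apply: cF; rewrite inE AF orbT.
    by apply: (IH (x :: y :: E)); apply: cF; rewrite mem_head.
  split; first exact: fin_heads.
  by move: hH => /= H; rewrite (leq_trans H) // ltnW.
- move=> F FS; apply/HF; case/HF: (FS) => [->|[F0 [n [/andP[n1 nF] SF]]]]; first by left.
  case: F => [//|x [|y F]] in FS F0 nF SF *; first by left.
  right; split=> //; exists n; split; last exact: IH SF.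
  move: (S_fin FS); rewrite fin_cons => /and3P[_ /andP[xy _] _].
  by rewrite n1 (leq_trans nF) //= ltnW.
Qed.

Lemma S_drop a n F : S a F -> S a (drop n F).
Proof.
by elim: n F => [|n IH] [|x F] //= H; apply: IH; exact: (S_behead H).
Qed.

Lemma S_le_succ a F : S a F -> S (OS a) F.
Proof.
move=> H; apply/S_succ; apply: conv_single => //; last exact: S_fin H.
by move=> n n0; rewrite /S1 /fin /= n0.
Qed.

(** Inclusion holds only beyond a threshold: at a limit [b], membership in the family of [h n]
    counts once the minimum is at least [n]. *)
Lemma S_tail a b : ole a b ->
  exists N, forall F, S a F -> (N <= head 0%N F)%N -> S b F.
Proof.
elim/S_ind: b => [b c e H ab|H|b IH ab|b h _ hm h2 h3 HF IH ab].
- have [N HN] := H (ole_trans ab e.1).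
  by exists N => F /HN H' /H'; exact: S_eq (oeq_sym e).
- by exists 0%N => F; move: (oeq_zero H) => e /(S_eq e).
- case: (ole_or_olt (OS b) a) => [ba|/ole_SS/IH[N HN]].
    by exists 0%N => F /(S_eq (conj ab ba)).
  by exists N => F /HN H /H; exact: S_le_succ.
- case: (ole_or_olt b a) => [ba|ltab].
    by exists 0%N => F /(S_eq (conj ab ba)).
  have [n Hn] := olt_lim_inv (olt_ole_trans ltab h3).
  have [N HN] := IH (h n.+1) (h2 n.+1) (olt_le (olt_ole_trans Hn (hm n))).
  exists (maxn N n.+1) => F SF; rewrite geq_max => /andP[NF nF].
  apply/HF; right; split; first by case: (F) nF.
  by exists n.+1; split; [rewrite nF|exact: HN].
Qed.

(* No term of [a] is absorbed in [a + b] here. *)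
Lemma S_le_add a g q b : oeq a (omul (oexp g) q) -> olt b (oexp g) ->
  forall F, S a F -> S (oadd a b) F.
Proof.
move=> ea; elim/olt_ind: b => b IH bg F SF.
case: (ord_cases b) => [H|[b' e]|/limit_last_term[d [g2 [e [bd de g20]]]]].
- exact: S_eq (oadd_eq (oeq_refl a) (oeq_sym H)) SF.
- apply: S_eq (oadd_eq (oeq_refl a) (oeq_sym e)) _; apply: S_le_succ.
  apply: IH => //; first exact: e.2.
  exact: ole_olt_trans (olt_le e.2) bg.
have [h [h1 h2 h3 h4]] := power_seq_exists g20.
have bg' : olt (oexp g2) (oexp g).
  apply: ole_olt_trans bg; apply: ole_trans bd.2; exact: oadd_le_selfr.
have [k Hk] := oadd_sub (olt_le (oexp_ltI bg')).
apply: (@S_eq (oadd (oadd a d) (oexp g2))).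
  by rewrite oaddA; apply: oadd_eq (oeq_refl a) (oeq_sym bd).
(* With [g = g2 + k], this multiplier exhibits [a + d] as a multiple of [omega^g2]. Hence the
   sequence chosen for [a + b] is [a + (d + h n)]; its term [n = 1] is available to every nonempty
   set. *)
apply/(h4 _ (oadd (omul (oexp k) q) e)).
  rewrite omulD -omulA -oexpD; apply: oadd_eq de.
  by apply: oeq_trans ea _; apply: omul_eq (oexp_eq Hk) (oeq_refl _).
case: F SF => [|x F] SF; [by left|right; split=> //; exists 1%N].
rewrite /= (fin_gt0 (S_fin SF)) ?mem_head //; split=> //.
rewrite oaddA; apply: IH => //; first exact: olt_ole_trans (oadd_lt d (h2 1%N)) bd.2.
exact: ole_olt_trans (olt_le (olt_ole_trans (oadd_lt d (h2 1%N)) bd.2)) bg.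
Qed.

Lemma conv_sub (M M' N N' : fam) F : (forall G, M G -> M' G) -> (forall G, N G -> N' G) ->
  conv M N F -> conv M' N' F.
Proof.
by move=> H H' [Fs [? c ? ?]]; exists Fs; split=> //; [move=> A /c; exact: H'|exact: H].
Qed.

(** Induction on [b]. A successor adds an outer [S1], handled by [convA]. At a limit, the sequence
    chosen for [a + b] is compared with the one chosen for [b = d + omega^g]; the comparison differs
    according to whether [d] is zero. *)
Theorem S_add_conv a b F : S (oadd a b) F -> conv (S b) (S a) F.
Proof.
elim/olt_ind: b a F => b IH a F SF.
case: (ord_cases b) => [H|[b' e]|/limit_last_term[d [g [e [bd de g0]]]]].
- have SF' : S a F by apply: S_eq SF; exact: (oadd_eq (oeq_refl a) H).
  apply: conv_single => //; first by move=> n; exact: S_single.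
  + exact: S_nil.
  + exact: S_fin SF.
- have /S_succ SF' : S (OS (oadd a b')) F.
    by apply: S_eq SF; exact: (oadd_eq (oeq_refl a) e).
  apply: (@conv_sub (S (OS b')) _ (S a)) => //; first by move=> G; apply: S_eq (oeq_sym e).
  apply: (@conv_sub (conv S1 (S b')) _ (S a)) => //; first by move=> G /S_succ.
  apply: convA; apply: conv_sub SF' => // G; apply: IH; exact: e.2.
have [h [h1 h2 h3 h4]] := power_seq_exists g0.
(* The list of minima starts with the minimum of [F], so the bound on [n] is also the one required
   for the outer family. *)
have lift n : (1 <= n <= head 0%N F)%N -> F <> [::] ->
    conv (S (oadd d (h n))) (S a) F -> conv (S b) (S a) F.
  move=> nF F0 [Fs [sF cF eF mF]]; exists Fs; split=> //.
  apply: S_eq (oeq_sym bd) _; apply/(h4 d e de); right.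
  have hF : head 0%N (map (head 0%N) Fs) = head 0%N F.
    by rewrite eF; move/successiveP: sF => /andP[]; case: (Fs) => [//|[//|]].
  split; first by move=> F'; move: nF; rewrite -hF F' => /andP[]; case: (n).
  by exists n; rewrite hF.
have hb n : olt (oadd d (h n)) b by exact: olt_ole_trans (oadd_lt d (h2 n)) bd.2.
(* If [b = omega^g], the remainder [r] of [a = omega^g q + r] is absorbed and the sequence for
   [a + b] is [omega^g q + h n]. The pieces then lie in the family of [omega^g q], which [S_le_add]
   places inside that of [a]. *)
case: (ole_or_olt d OZ) => [/oeq_zero d0|d0].
  have [q [r [ar rg]]] := ord_div a g.
  have : S (oadd (omul (oexp g) q) (oexp g)) F.
    apply: S_eq SF; apply: oeq_trans (oadd_eq ar bd) _; rewrite oaddA.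
    apply: oadd_eq (oeq_refl _) _; apply: oeq_trans (oexp_absorb rg).
    by apply: oadd_eq (oeq_refl _) _; rewrite -[X in oeq _ X]oadd0l; apply: oadd_eq d0 (oeq_refl _).
  have dh n : oeq (h n) (oadd d (h n)).
    by rewrite -[X in oeq X _]oadd0l; apply: oadd_eq (oeq_sym d0) (oeq_refl _).
  move=> /(h4 _ q (oeq_refl _))[->|[F0 [n [nF SF']]]].
    by exists [::]; split=> //; exact: S_nil.
  apply: (lift n) => //; apply: conv_sub (IH (h n) _ _ _ SF') => //.
  + by move=> G; exact: S_eq.
  + move=> G /(S_le_add (oeq_refl _) rg); exact: S_eq (oeq_sym ar).
  + exact: ole_olt_trans (dh n).1 (hb n).
have e0 : olt OZ e.
  by apply: not_ole => /(omul_lel (oexp g)) H; case: (olt_irr (olt_ole_trans d0 (ole_trans de.1 H))).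
(* If [d > 0], then [a + d] is again a multiple of [omega^g], so the sequence for [a + b] is [a]
   followed by the one for [b]. *)
have [e' He'] := oadd_multiple a g e0.
have : S (oadd (oadd a d) (oexp g)) F.
  by apply: S_eq SF; rewrite oaddA; apply: oadd_eq (oeq_refl _) bd.
move=> /(h4 _ e')[].
- by apply: oeq_trans He'; apply: oadd_eq (oeq_refl _) de.
- by move=> ->; exists [::]; split=> //; exact: S_nil.
- by move=> [F0 [n [nF SF']]]; apply: (lift n) => //; apply: IH => //; rewrite -oaddA.
Qed.

End Schreier.

(** * The norm on finitely supported vectors *)

Local Open Scope ring_scope.

Section Norm.
Variable R : realType.
Notation vec := (nat -> R).
Implicit Types (x y : vec) (E F : seq nat) (Es : seq (seq nat)).

Definition supp_le (N : nat) x : Prop := forall i, ~~ (0 < i <= N)%N -> x i = 0.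

Lemma supp_le_trunc N x : supp_le N (trunc N x).
Proof. by move=> i /negbTE; rewrite /trunc => ->. Qed.

Lemma supp_le_restr N E x : supp_le N x -> supp_le N (restr E x).
Proof. by move=> H i /H; rewrite /restr => ->; case: ifP. Qed.

Lemma supp_leW N M x : (N <= M)%N -> supp_le N x -> supp_le M x.
Proof.
move=> NM H i; rewrite negb_and => /orP[i0|iM]; apply: H; first by rewrite negb_and i0.
by rewrite negb_and orbC -ltnNge (leq_ltn_trans NM) // ltnNge.
Qed.

Lemma supp_le_scale N a x : supp_le N x -> supp_le N (fun i => a * x i).
Proof. by move=> Hx i Hi; rewrite Hx // mulr0. Qed.

Lemma supp_le_sum (T : Type) N (r : seq T) (a : T -> R) (v : T -> vec) :
  (forall b, supp_le N (v b)) -> supp_le N (fun i => \sum_(b <- r) a b * v b i).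
Proof. by move=> H i Hi; rewrite big1 // => b _; rewrite H // mulr0. Qed.

Lemma trunc_restr N x : trunc N x = restr (iota 1 N) x.
Proof. by apply: funext => i; rewrite /restr /trunc mem_iota add1n ltnS. Qed.

Lemma trunc_id N M x : supp_le N x -> (N <= M)%N -> trunc M x = x.
Proof.
move=> Hx NM; apply: funext => i; rewrite /trunc; case: ifPn => // /(supp_leW NM Hx) ->//.
Qed.

Lemma restr_restr E F x : {subset E <= F} -> restr E (restr F x) = restr E x.
Proof.
by move=> EF; apply: funext => i; rewrite /restr; case: ifP => // /EF ->.
Qed.

Lemma restr_comm E F x : restr E (restr F x) = restr F (restr E x).
Proof. by apply: funext => i; rewrite /restr; do 2!case: ifP. Qed.

(** A common bound for all iterates of the norm on vectors supported in [[1, N]]: the real [sup] is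
    0 on unbounded sets, so its upper bound property needs one. *)
Definition l1norm (N : nat) x : R := \sum_(i < N.+1) `|x i|.

Lemma l1norm_ge N x i : supp_le N x -> `|x i| <= l1norm N x.
Proof.
move=> Hx; have [iN|iN] := leqP i N; last first.
  by rewrite Hx ?normr0 ?sumr_ge0 // negb_and orbC -ltnNge iN.
rewrite /l1norm (bigD1 (Ordinal (iN : (i < N.+1)%N))) //= lerDl.
by apply: sumr_ge0 => j _; exact: normr_ge0.
Qed.

Lemma norm_restr_flatten Es x i : uniq (flatten Es) ->
  \sum_(E <- Es) `|restr E x i| = `|restr (flatten Es) x i|.
Proof.
elim: Es => [_|E Es IH /=]; first by rewrite big_nil /restr normr0.
rewrite cat_uniq => /and3P[_ /hasPn d /IH H]; rewrite big_cons H /restr mem_cat.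
case: (boolP (i \in flatten Es)) => [/d /negbTE ->|_] /=; first by rewrite normr0 add0r.
by rewrite normr0 addr0 orbF.
Qed.

Lemma fin_uniq F : fin F -> uniq F.
Proof. by move=> /andP[/sorted_uniq H _]; apply: H; [exact: ltn_trans|exact: ltnn]. Qed.

Lemma successive_uniq Es : successive Es -> uniq (flatten Es).
Proof. by move=> /successiveP/andP[_ /fin_uniq]. Qed.

Lemma l1norm_successive N Es x : successive Es ->
  \sum_(E <- Es) l1norm N (restr E x) <= l1norm N x.
Proof.
move=> /successive_uniq U; rewrite exchange_big; apply: ler_sum => i _.
by rewrite norm_restr_flatten // /restr; case: ifP => // _; rewrite normr0.
Qed.

Lemma norm0_le x B : (forall i, `|x i| <= B) -> norm0 x <= B.
Proof. by move=> H; apply: ge_sup; [exists `|x 0%N|, 0%N|move=> _ [i _ <-]]. Qed.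

Lemma norm0_ge N x i : supp_le N x -> `|x i| <= norm0 x.
Proof.
move=> Hx; apply: ub_le_sup; last by exists i.
by exists (l1norm N x) => _ [j _ <-]; exact: l1norm_ge.
Qed.

Lemma norm0_ge0 N x : supp_le N x -> 0 <= norm0 x.
Proof. by move/norm0_ge => H; exact: le_trans (H 0%N). Qed.

Variables (theta : nat -> R) (Fn : nat -> fam).
Hypothesis theta01 : forall n, 0 < theta n < 1.
Hypothesis Fn_nil : forall n, Fn n [::].

Let theta_ge0 n : 0 <= theta n.
Proof. by case/andP: (theta01 n) => /ltW. Qed.
Let theta_le1 n : theta n <= 1.
Proof. by case/andP: (theta01 n) => _ /ltW. Qed.

Notation nrm := (normit theta Fn).
Notation tn := (tnorm theta Fn).

Let adm_set m x := [set r : R | exists n Es, admissible (Fn n) Es /\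
                      r = theta n * \sum_(E <- Es) nrm m (restr E x)]%classic.

Let adm_set0 m x : (adm_set m x !=set0)%classic.
Proof. by exists 0, 0%N, [::]; rewrite big_nil mulr0. Qed.

Lemma normit_ge0 m N x : supp_le N x -> 0 <= nrm m x.
Proof.
by case: m => [|m] /= Hx; rewrite ?le_max (norm0_ge0 Hx).
Qed.

Lemma normit_le_l1 m N x : supp_le N x -> nrm m x <= l1norm N x.
Proof.
elim: m x => [|m IH] x Hx /=; first by apply: norm0_le => i; exact: l1norm_ge.
rewrite ge_max; apply/andP; split; first by apply: norm0_le => i; exact: l1norm_ge.
apply: (ge_sup (adm_set0 m x)) => _ [n [Es [[sE _] ->]]].
apply: le_trans (l1norm_successive N x sE).
apply: le_trans (_ : \sum_(E <- Es) nrm m (restr E x) <= _).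
  apply: ler_piMl => //; apply: sumr_ge0 => E _.
  by apply: (@normit_ge0 _ N); exact: supp_le_restr.
by apply: ler_sum => E _; apply: IH; exact: supp_le_restr.
Qed.

Lemma normit_coord m N x i : supp_le N x -> `|x i| <= nrm m x.
Proof.
by move=> Hx; case: m => [|m] /=; rewrite ?le_max (norm0_ge i Hx).
Qed.

Lemma normit_adm m N x n Es : supp_le N x -> admissible (Fn n) Es ->
  theta n * \sum_(E <- Es) nrm m (restr E x) <= nrm m.+1 x.
Proof.
move=> Hx aE /=; rewrite le_max; apply/orP; right.
apply: (@ub_le_sup _ (adm_set m x)); last by exists n, Es.
exists (l1norm N x) => _ [k [Fs [[sF _] ->]]].
apply: le_trans (l1norm_successive N x sF).
apply: le_trans (_ : \sum_(E <- Fs) nrm m (restr E x) <= _).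
  apply: ler_piMl => //; apply: sumr_ge0 => E _.
  by apply: (@normit_ge0 _ N); exact: supp_le_restr.
by apply: ler_sum => E _; apply: normit_le_l1; exact: supp_le_restr.
Qed.

Lemma normit_le m x B : (forall i, `|x i| <= B) ->
  (forall n Es, admissible (Fn n) Es -> theta n * \sum_(E <- Es) nrm m (restr E x) <= B) ->
  nrm m.+1 x <= B.
Proof.
move=> H1 H2 /=; rewrite ge_max norm0_le //=.
by apply: (ge_sup (adm_set0 m x)) => _ [n [Es [aE ->]]]; exact: H2.
Qed.

Lemma normit_mono m N x : supp_le N x -> nrm m x <= nrm m.+1 x.
Proof.
elim: m x => [|m IH] x Hx; first by rewrite [leRHS]/= le_max lexx.
apply: normit_le => [i|n Es aE]; first exact: normit_coord Hx.
apply: le_trans (normit_adm m.+1 Hx aE); apply: ler_wpM2l => //.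
by apply: ler_sum => E _; apply: IH; exact: supp_le_restr.
Qed.

Lemma normit_homo m k N x : supp_le N x -> (m <= k)%N -> nrm m x <= nrm k x.
Proof.
move=> Hx; elim: k => [|k IH]; first by rewrite leqn0 => /eqP ->.
rewrite leq_eqVlt => /predU1P[-> //|/IH H]; exact: le_trans H (normit_mono k Hx).
Qed.

Lemma normit_tnorm m N x : supp_le N x -> nrm m x <= tn x.
Proof.
move=> Hx; apply: ub_le_sup; last by exists m.
by exists (l1norm N x) => _ [k _ <-]; exact: normit_le_l1.
Qed.

Lemma tnorm_le_normit x B : (forall m, nrm m x <= B) -> tn x <= B.
Proof. by move=> H; apply: ge_sup; [exists (nrm 0%N x), 0%N|move=> _ [m _ <-]]. Qed.

Lemma tnorm_coord N x i : supp_le N x -> `|x i| <= tn x.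
Proof. by move=> Hx; apply: le_trans (normit_coord 0 i Hx) (normit_tnorm 0 Hx). Qed.

Lemma tnorm_ge0 N x : supp_le N x -> 0 <= tn x.
Proof. by move=> Hx; apply: le_trans (tnorm_coord 0 Hx). Qed.

Lemma tnorm_le_l1 N x : supp_le N x -> tn x <= l1norm N x.
Proof. by move=> Hx; apply: tnorm_le_normit => m; exact: normit_le_l1. Qed.

(** Together with [tnorm_coord] and [tnorm_adm] this is the implicit equation of the norm, which
    frees later estimates from the iterates. *)
Lemma tnorm_le N x B : supp_le N x -> (forall i, `|x i| <= B) ->
  (forall n Es, admissible (Fn n) Es -> theta n * \sum_(E <- Es) tn (restr E x) <= B) ->
  tn x <= B.
Proof.
move=> Hx H1 H2; apply: tnorm_le_normit => -[|m]; first exact: norm0_le.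
apply: normit_le => // n Es aE; apply: le_trans (H2 n Es aE); apply: ler_wpM2l => //.
by apply: ler_sum => E _; apply: (@normit_tnorm _ N); exact: supp_le_restr.
Qed.

(* The iterates increase in [m], so the supremum passes through finite sums. *)
Lemma sum_tnorm_le N x Es B : supp_le N x ->
  (forall m, \sum_(E <- Es) nrm m (restr E x) <= B) -> \sum_(E <- Es) tn (restr E x) <= B.
Proof.
move=> Hx H; apply/ler_addgt0Pr => e e0.
have [m Hm] : exists m, \sum_(E <- Es) tn (restr E x) <= \sum_(E <- Es) nrm m (restr E x) + e.
  elim: Es e e0 {H} => [|E Es IH] e e0; first by exists 0%N; rewrite !big_nil add0r ltW.
  have e2 : 0 < e / 2 by rewrite divr_gt0.
  have [m Hm] := IH _ e2.
  have [k Hk] : exists k, tn (restr E x) <= nrm k (restr E x) + e / 2.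
    have HE := supp_le_restr E Hx; case: (pselect (exists k, tn (restr E x) <= nrm k (restr E x) + e / 2)) => //.
    move=> /forallNP Hk; have : tn (restr E x) <= tn (restr E x) - e / 2.
      apply: tnorm_le_normit => k; rewrite lerBrDr ltW // ltNge; apply/negP; exact: Hk.
    by rewrite lerBrDr gerDl leNgt e2.
  exists (maxn m k); rewrite !big_cons (splitr e) addrACA lerD //.
    by apply: le_trans Hk _; rewrite lerD2r (@normit_homo _ _ N) ?leq_maxr //; exact: supp_le_restr.
  apply: le_trans Hm _; rewrite lerD2r; apply: ler_sum => F _.
  by rewrite (@normit_homo _ _ N) ?leq_maxl //; exact: supp_le_restr.
by apply: le_trans Hm _; rewrite lerD2r.
Qed.

Lemma tnorm_adm N x n Es : supp_le N x -> admissible (Fn n) Es ->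
  theta n * \sum_(E <- Es) tn (restr E x) <= tn x.
Proof.
move=> Hx aE; have t0 : 0 < theta n by case/andP: (theta01 n).
rewrite mulrC -ler_pdivlMr //; apply: (@sum_tnorm_le N) => // m.
by rewrite ler_pdivlMr // mulrC (le_trans (normit_adm m Hx aE)) // (normit_tnorm _ Hx).
Qed.

Lemma normit_restr m N E x : supp_le N x -> nrm m (restr E x) <= nrm m x.
Proof.
move=> Hx; elim: m x Hx => [|m IH] x Hx.
  apply: norm0_le => i; rewrite /restr; case: ifP => _; first exact: norm0_ge Hx.
  by rewrite normr0 (norm0_ge0 Hx).
apply: normit_le => [i|n Es aE].
  rewrite /restr; case: ifP => _; first exact: normit_coord Hx.
  by rewrite normr0 (normit_ge0 _ Hx).
apply: le_trans (normit_adm m Hx aE); apply: ler_wpM2l => //.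
by apply: ler_sum => F _; rewrite restr_comm; apply: IH; exact: supp_le_restr.
Qed.

Lemma tnorm_restr N E x : supp_le N x -> tn (restr E x) <= tn x.
Proof.
move=> Hx; apply: tnorm_le_normit => m.
exact: le_trans (normit_restr m E Hx) (normit_tnorm m Hx).
Qed.

Lemma tnorm_trunc N M x : supp_le N x -> tn (trunc M x) <= tn x.
Proof. by rewrite trunc_restr; exact: tnorm_restr. Qed.

Lemma normit_add m N x y : supp_le N x -> supp_le N y ->
  nrm m (fun i => x i + y i) <= nrm m x + nrm m y.
Proof.
elim: m x y => [|m IH] x y Hx Hy.
  apply: norm0_le => i; apply: le_trans (ler_normD _ _) _.
  by rewrite lerD // (norm0_ge _ Hx, norm0_ge _ Hy).
apply: normit_le => [i|n Es aE].
  by apply: le_trans (ler_normD _ _) _; rewrite lerD // (normit_coord _ _ Hx, normit_coord _ _ Hy).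
apply: le_trans (lerD (normit_adm m Hx aE) (normit_adm m Hy aE)).
rewrite -mulrDr -big_split /=; apply: ler_wpM2l => //; apply: ler_sum => E _.
have -> : restr E (fun i => x i + y i) = (fun i => restr E x i + restr E y i).
  by apply: funext => i; rewrite /restr; case: ifP; rewrite ?addr0.
by apply: IH; exact: supp_le_restr.
Qed.

Lemma tnorm_add N x y : supp_le N x -> supp_le N y ->
  tn (fun i => x i + y i) <= tn x + tn y.
Proof.
move=> Hx Hy; apply: tnorm_le_normit => m; apply: le_trans (normit_add m Hx Hy) _.
by rewrite lerD // (normit_tnorm _ Hx, normit_tnorm _ Hy).
Qed.

Lemma tnorm_scale N a x : supp_le N x -> tn (fun i => a * x i) <= `|a| * tn x.
Proof.
move=> Hx; apply: tnorm_le_normit => m.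
apply: le_trans (_ : `|a| * nrm m x <= _); last by rewrite ler_wpM2l // (normit_tnorm _ Hx).
elim: m x Hx => [|m IH] x Hx.
  by apply: norm0_le => i; rewrite normrM ler_wpM2l // (norm0_ge _ Hx).
apply: normit_le => [i|n Es aE].
  by rewrite normrM ler_wpM2l // (normit_coord _ _ Hx).
apply: le_trans (_ : `|a| * (theta n * \sum_(E <- Es) nrm m (restr E x)) <= _); last first.
  by rewrite ler_wpM2l // (normit_adm _ Hx).
rewrite mulrCA; apply: ler_wpM2l => //; rewrite mulr_sumr; apply: ler_sum => E _.
have -> : restr E (fun i => a * x i) = (fun i => a * restr E x i).
  by apply: funext => i; rewrite /restr; case: ifP; rewrite ?mulr0.
by apply: IH; exact: supp_le_restr.
Qed.

Lemma tnorm_zero : tn (fun _ => 0) = 0.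
Proof.
have H : supp_le 0 (fun _ : nat => 0 : R) by [].
apply/eqP; rewrite eq_le (tnorm_ge0 H) andbT; apply: le_trans (tnorm_le_l1 H) _.
by rewrite /l1norm big1 // => i _; rewrite normr0.
Qed.

Lemma tnorm_sum (T : Type) N (r : seq T) (a : T -> R) (v : T -> vec) :
  (forall b, supp_le N (v b)) ->
  tn (fun i => \sum_(b <- r) a b * v b i) <= \sum_(b <- r) `|a b| * tn (v b).
Proof.
move=> H; elim: r => [|b r IH].
  rewrite big_nil (_ : (fun i => _) = fun _ => 0) ?tnorm_zero //.
  by apply: funext => i; rewrite big_nil.
rewrite big_cons (_ : (fun i => _) = fun i => a b * v b i + \sum_(b <- r) a b * v b i); last first.
  by apply: funext => i; rewrite big_cons.
apply: le_trans (@tnorm_add N _ _ _ _) _; [exact: supp_le_scale|exact: supp_le_sum|].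
by rewrite lerD //; exact: tnorm_scale (H b).
Qed.

End Norm.

(** * Regrouping admissible sequences *)

Lemma flatten_map_flatten (T : Type) (Gs : seq (seq (seq T))) :
  flatten (map flatten Gs) = flatten (flatten Gs).
Proof. by elim: Gs => //= G Gs ->; rewrite flatten_cat. Qed.

Notation min2 G := (head 0%N (head [::] G)).

(** The decomposition lives on the minima; reshaping [Es] by its block sizes transports it to the
    sets themselves. *)
Lemma conv_groups (M N : fam) (Es : seq (seq nat)) : conv M N (map (head 0%N) Es) ->
  exists Gs, [/\ Es = flatten Gs, all (fun G => G != [::]) Gs,
    forall G, G \in Gs -> N (map (head 0%N) G) & M (map (fun G => min2 G) Gs)].
Proof.
move=> [Hs [/successiveP/andP[aH _] cH eH mH]].
have szE : size Es = sumn (shape Hs) by rewrite -size_flatten -eH size_map.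
have eG : map (map (head 0%N)) (reshape (shape Hs) Es) = Hs.
  by rewrite map_reshape eH flattenK.
have eG0 G : (G != [::]) = (map (head 0%N) G != [::]) by case: G.
have aG : all (fun G => G != [::]) (reshape (shape Hs) Es).
  apply/allP=> G /(map_f (map (head 0%N))); rewrite eG eG0.
  exact: (allP aH).
exists (reshape (shape Hs) Es); split=> //.
- by rewrite reshapeKr // szE.
- by move=> G /(map_f (map (head 0%N))); rewrite eG; exact: cH.
- suff <- : map (head 0%N) Hs = map (fun G => min2 G) (reshape (shape Hs) Es) by [].
  rewrite -{1}eG -map_comp; apply/eq_in_map => G /(allP aG).
  by case: G.
Qed.

Section Groups.
Variables (R : realType) (theta : nat -> R) (beta : nat -> Ord)
  (fs : Ord -> nat -> Ord) (S : Ord -> fam).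
Hypotheses (theta01 : forall n, 0 < theta n < 1)
  (theta_mono : forall n, theta n.+1 <= theta n)
  (Hfs : fund_seq fs) (HS : schreier_system fs S).
Notation vec := (nat -> R).
Notation Fn := (fun n => S (beta n)).
Notation tn := (tnorm theta Fn).

Lemma theta_gt0 n : 0 < theta n. Proof. by case/andP: (theta01 n). Qed.

Lemma theta_le0 n : theta n <= theta 0%N.
Proof. by elim: n => // n; apply: le_trans (theta_mono n). Qed.

Lemma Fn_nil n : Fn n [::]. Proof. exact: S_nil Hfs HS _. Qed.

Lemma prod_theta_ge0 (l : seq nat) : 0 <= \prod_(n <- l) theta n.
Proof. by apply: prodr_ge0 => n _; exact: ltW (theta_gt0 n). Qed.

(** Iterates the admissibility inequality along [l]: by [S_add_conv] the sets fall into groups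
    treated by the tail of [l], and the unions of the groups are admissible for [beta n]. For empty
    [l], the family [S OZ] allows at most one set. *)
Lemma osum_adm N (x : vec) l Es : supp_le N x -> successive Es ->
  S (osum beta l) (map (head 0%N) Es) ->
  (\prod_(n <- l) theta n) * \sum_(E <- Es) tn (restr E x) <= tn x.
Proof.
elim: l x Es => [|n l IH] x Es Hx sE.
  move=> /= /(S_zero HS) HE; rewrite big_nil mul1r.
  have : (size Es <= 1)%N by rewrite -(size_map (head 0%N)); case: HE => [->|[k [_ ->]]].
  case: Es {sE HE} => [|E [|//]] _; first by rewrite big_nil (tnorm_ge0 theta01 Fn_nil Hx).
  by rewrite big_seq1 (tnorm_restr theta01 Fn_nil _ Hx).
move=> /= /(S_add_conv Hfs HS)/conv_groups[Gs [eE aG cG mG]].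
have sG G : G \in Gs -> successive G.
  move=> GG; case/splitPr: GG eE => G1 G2 eE; move: sE.
  by rewrite eE flatten_cat => /successive_cat[_] /= /successive_cat[].
have hG G : G \in Gs -> head 0%N (flatten G) = min2 G /\ flatten G != [::].
  move=> GG; have /successiveP/andP[aE _] := sG _ GG.
  by move/allP: aG => /(_ _ GG); case: (G) aE => [//|[//|]].
have sF : successive (map flatten Gs).
  apply/successiveP; rewrite flatten_map_flatten -eE; move/successiveP: sE => /andP[_ ->].
  by rewrite andbT; apply/allP => F /mapP[G /hG[_ GG] ->].
have aF : admissible (Fn n) (map flatten Gs).
  split=> //; rewrite -map_comp; rewrite (_ : map _ Gs = map (fun G => min2 G) Gs) //.
  by apply/eq_in_map => G /hG[].
apply: le_trans (tnorm_adm theta01 Fn_nil Hx aF); rewrite big_cons -mulrA.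
rewrite ler_pM2l ?theta_gt0 //.
rewrite {1}eE big_flatten big_map /= mulr_sumr big_seq [leRHS]big_seq.
apply: ler_sum => G GG.
apply: le_trans (IH _ G (supp_le_restr (flatten G) Hx) (sG G GG) (cG G GG)).
apply: (ler_wpM2l (prod_theta_ge0 l)); rewrite big_seq [leRHS]big_seq; apply: ler_sum => E EG.
rewrite restr_restr // => i iE; apply/flattenP; by exists E.
Qed.

Definition supp_in (lo hi : nat) (v : vec) : Prop := forall i, ~~ (lo <= i <= hi)%N -> v i = 0.

Lemma tnorm_restr_out lo hi v E : supp_in lo hi v ->
  (forall i, i \in E -> ~~ (lo <= i <= hi)%N) -> tn (restr E v) = 0.
Proof.
move=> Hv HE; rewrite (_ : restr E v = fun _ => 0) ?tnorm_zero //; first exact: Fn_nil.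
by apply: funext => i; rewrite /restr; case: ifP => // /HE/Hv.
Qed.

(** With no group starting inside [[lo, hi]], at most one group meets it: a next group starting
    below [lo] leaves the current one to the left of the interval, and one starting beyond [hi] puts
    all later groups to its right. *)
Lemma one_group lo hi v Gs B : supp_in lo hi v -> successive (flatten Gs) ->
  all (fun G => G != [::]) Gs -> 0 <= B ->
  (forall G, G \in Gs -> ~~ (lo <= min2 G <= hi)%N /\ \sum_(E <- G) tn (restr E v) <= B) ->
  \sum_(E <- flatten Gs) tn (restr E v) <= B.
Proof.
move=> Hv; elim: Gs => [|G Gs IH]; first by rewrite big_nil.
move=> sG /= /andP[G0 aG] B0 HG.
have [HG1 HG2] := HG G (mem_head _ _).
have [sG1 sG2] := successive_cat sG.
case: Gs => [|G' Gs] in IH sG aG HG sG2 *; first by rewrite cats0.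
have [HG'1 _] : ~~ (lo <= min2 G' <= hi)%N /\ \sum_(E <- G') tn (restr E v) <= B.
  by apply: HG; rewrite !inE eqxx orbT.
have h' : head 0%N (flatten (flatten (G' :: Gs))) = min2 G' /\
          flatten (flatten (G' :: Gs)) != [::].
  move/successiveP: sG2 => /andP[]; case/andP: aG => [].
  by case: (G') => [//|[//|]].
move: HG'1; rewrite negb_and -!ltnNge => /orP[h'lo|hih'].
  rewrite big_cat /= big_seq big1 ?add0r.
    by apply: IH => // G2 GG; apply: HG; rewrite inE GG orbT.
  move=> E EG; apply: (tnorm_restr_out Hv) => i iE; rewrite negb_and -!ltnNge.
  apply/orP; left; apply: ltn_trans h'lo.
  move/successiveP: sG => /andP[_]; rewrite [flatten (_ :: _)]/= flatten_cat fin_catE.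
  case/and3P => /allrelP r _ _; case: h' => <- n0; apply: r.
    by apply/flattenP; exists E.
  by case: (flatten _) n0 => //= *; rewrite mem_head.
rewrite big_cat /= [X in _ + X]big_seq [X in _ + X]big1 ?addr0 //.
move=> E EG; apply: (tnorm_restr_out Hv) => i iE; rewrite negb_and -!ltnNge.
apply/orP; right; apply: leq_trans hih' _.
case: h' => <- _; apply: head_le; first by move/successiveP: sG2 => /andP[].
by apply/flattenP; exists E.
Qed.

(** [H] consists of the minima of the groups formed by the sets starting at or after [N]; it does
    not depend on [v]. On one group, [theta m] is below [e] times the product along [l], and
    [osum_adm] bounds the product times the sum by the norm. The term [theta 0 * B] covers single
    sets. *)
Lemma group_bound e delta m N l Es : 0 < e ->
  l = [::] \/ theta m < e * \prod_(n <- l) theta n ->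
  (forall F, S (beta m) F -> (N <= head 0%N F)%N -> S (oadd (osum beta l) delta) F) ->
  admissible (Fn m) Es ->
  exists2 H, S delta H & forall lo hi v B, supp_in lo hi v -> (0 < lo)%N -> (N <= lo)%N ->
    ~~ has (fun h => lo <= h <= hi)%N H -> tn v <= B -> B <= 1 ->
    theta m * \sum_(E <- Es) tn (restr E v) <= Num.max e (theta 0%N * B).
Proof.
move=> e0 Hl HN [sE SE]; pose k := find (fun E => N <= head 0%N E)%N Es.
have [H SH [Gs [eE aG cG mG]]] : exists2 H, S delta H & exists Gs,
    [/\ drop k Es = flatten Gs, all (fun G => G != [::]) Gs,
    forall G, G \in Gs -> S (osum beta l) (map (head 0%N) G) & H = (map (fun G => min2 G) Gs)].
  case E : (drop k Es) => [|E0 Es'].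
    by exists [::]; [exact: S_nil Hfs HS _|exists [::]].
  have : S (beta m) (map (head 0%N) (drop k Es)) by rewrite map_drop; exact: (S_drop Hfs HS).
  move/HN; rewrite E /=; have -> : (N <= head 0%N E0)%N.
    have kE : (k < size Es)%N by rewrite ltnNge; apply/negP => /drop_oversize; rewrite E.
    have := nth_find [::] (_ : has (fun E => N <= head 0%N E)%N Es).
    by rewrite has_find kE => /(_ isT); rewrite -/k -[k]addn0 -nth_drop E.
  move=> /(_ isT)/(S_add_conv Hfs HS)/(@conv_groups _ _ (E0 :: Es'))[Gs [eE aG cG mG]].
  by exists (map (fun G => min2 G) Gs) => //; exists Gs.
exists H => // lo hi v B Hv lo0 Nlo nH tvB B1.
have Hvs : supp_le hi v.
  move=> i Hi; apply: Hv; apply: contra Hi => /andP[H1 H2].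
  by rewrite H2 andbT (leq_trans lo0).
have tv0 := tnorm_ge0 theta01 Fn_nil Hvs.
have tm := theta_gt0 m.
have M0 : 0 <= Num.max e (theta 0%N * B) by rewrite le_max ltW.
rewrite mulrC -ler_pdivlMr //.
(* Sets starting before [N] become groups of one; their minima lie below [N <= lo], outside the
   interval. *)
pose Gs' := map (fun E => [:: E]) (take k Es) ++ Gs.
have eG : flatten Gs' = Es.
  by rewrite flatten_cat flatten_seq1 -eE cat_take_drop.
rewrite -{1}eG; apply: (one_group Hv).
- by rewrite eG.
- by rewrite all_cat aG andbT; apply/allP => G /mapP[E _ ->].
- by rewrite divr_ge0 // ltW.
move=> G; rewrite mem_cat => /orP[/mapP[E EE ->]|GG].
  split.
    rewrite negb_and -ltnNge /=; apply/orP; left; apply: leq_trans Nlo.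
    move/(nthP [::]): EE => [j]; rewrite size_takel ?find_size // => jk <-.
    by rewrite nth_take // ltnNge; have := before_find [::] jk => ->.
  rewrite big_seq1 ler_pdivlMr // mulrC le_max; apply/orP; right.
  apply: le_trans (_ : theta m * B <= _).
    apply: (ler_wpM2l (ltW tm)); exact: le_trans (tnorm_restr theta01 Fn_nil _ Hvs) tvB.
  apply: ler_wpM2r (theta_le0 m); exact: le_trans tvB.
split.
  by apply: contra nH => G1; apply/hasP; exists (min2 G) => //; rewrite mG; apply/mapP; exists G.
have sG : successive G.
  have : successive (flatten Gs) by rewrite -eE; move: sE; rewrite -{1}(cat_take_drop k Es) => /successive_cat[].
  case/splitPr: GG => G1 G2.
  by rewrite flatten_cat => /successive_cat[_] /= /successive_cat[].
have := osum_adm Hvs sG (cG G GG); set s := \sum_(E <- G) _ => Hs.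
have s0 : 0 <= s.
  by apply: sumr_ge0 => E _; exact: (tnorm_ge0 theta01 Fn_nil (supp_le_restr E Hvs)).
rewrite ler_pdivlMr // mulrC le_max; apply/orP; case: Hl => [l0|Hl]; [right|left].
  move: Hs; rewrite l0 big_nil mul1r => Hs.
  apply: le_trans (_ : theta m * B <= _).
    apply: (ler_wpM2l (ltW tm)); exact: le_trans Hs tvB.
  apply: ler_wpM2r (theta_le0 m); exact: le_trans tvB.
apply: le_trans (_ : e * (\prod_(n <- l) theta n * s) <= _).
  by rewrite mulrA; apply: ler_wpM2r => //; exact: ltW.
rewrite -[leRHS]mulr1; apply: (ler_wpM2l (ltW e0)).
exact: le_trans Hs (le_trans tvB B1).
Qed.

End Groups.

(** * Averages along derived trees *)

Section DerivedTrees.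
Variable R : realType.
Notation vec := (nat -> R).
Implicit Types (U V : seq vec -> Prop) (s : seq vec).

Lemma dtree_le U a b s : ole a b -> dtree U b s -> dtree U a s.
Proof.
have dT c t : dtree U c t -> U t.
  by elim: c t => [//|c IH|f IH] t /=; [move=> [/IH]|move=> /(_ 0%N)/IH].
move=> H; elim: H s => [c|c d _ IH|c d _ IH|f c _ IH|c f n _ IH] s.
- exact: dT.
- by move=> [/IH H [x /IH H']]; split=> //; exists x.
- by move=> [/IH].
- by move=> H n; exact: IH.
- by move=> /(_ n)/IH.
Qed.

Lemma dtree_root U a s : dtree U a s -> U s.
Proof. exact: dtree_le (ole_zero a). Qed.

Lemma dtree_add U a b : dtree U (oadd a b) = dtree (dtree U a) b.
Proof.
elim: b => [//|b /= -> //|f IH] /=; apply: funext => s.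
by apply: eq_forall => n; rewrite IH.
Qed.

Lemma dtree_nat U n s : dtree U (onat n) s -> exists2 t, size t = n & U (s ++ t).
Proof.
elim: n s => [|n IH] s /=; first by exists [::]; rewrite ?cats0.
move=> [_ [x /IH[t tn Ut]]]; exists (x :: t); first by rewrite /= tn.
by rewrite -cat_rcons.
Qed.

End DerivedTrees.

Section Averages.
Variables (R : realType) (theta : nat -> R) (beta : nat -> Ord)
  (fs : Ord -> nat -> Ord) (S : Ord -> fam).
Hypotheses (theta01 : forall n, 0 < theta n < 1)
  (theta_mono : forall n, theta n.+1 <= theta n)
  (Hfs : fund_seq fs) (HS : schreier_system fs S).
Notation vec := (nat -> R).
Notation Fn := (fun n => S (beta n)).
Notation tn := (tnorm theta Fn).
Let Fnil := Fn_nil beta Hfs HS.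

Definition lin (cs : seq R) (t : seq vec) : vec := fun j => \sum_(p <- zip cs t) p.1 * p.2 j.

Lemma lin_cat c1 c2 t1 t2 j : size c1 = size t1 ->
  lin (c1 ++ c2) (t1 ++ t2) j = lin c1 t1 j + lin c2 t2 j.
Proof. by move=> s1; rewrite /lin zip_cat // big_cat. Qed.

Lemma lin_scale a cs t j : lin (map (fun c => a * c) cs) t j = a * lin cs t j.
Proof.
rewrite /lin; elim: cs t => [|c cs IH] [|x t]; rewrite /= ?big_nil ?mulr0 //.
by rewrite !big_cons /= IH mulrDr mulrA.
Qed.

(** Testing all truncations measures the error in the completed space through finitely supported
    vectors. The error scales with [w], so [tau] survives convex combinations. *)
Definition approx (tau w : R) (t : seq vec) (y : vec) : Prop :=
  exists cs, [/\ size cs = size t, \sum_(c <- cs) `|c| = w &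
    forall N, tn (trunc N (fun j => lin cs t j - y j)) <= w * tau].

Lemma approx_nil tau : approx tau 0 [::] (fun _ => 0).
Proof.
exists [::]; split=> //; first by rewrite big_nil.
move=> N; rewrite mul0r (_ : trunc N _ = fun _ => 0) ?tnorm_zero //.
by apply: funext => j; rewrite /trunc /lin big_nil subr0 if_same.
Qed.

Lemma approx_cat tau a w1 w2 t1 t2 y1 y2 : 0 <= a ->
  approx tau w1 t1 y1 -> approx tau w2 t2 y2 ->
  approx tau (a * w1 + w2) (t1 ++ t2) (fun j => a * y1 j + y2 j).
Proof.
move=> a0 [c1 [s1 sum1 H1]] [c2 [s2 sum2 H2]].
exists (map (fun c => a * c) c1 ++ c2); split.
- by rewrite !size_cat size_map s1 s2.
- rewrite big_cat big_map /= sum2 -sum1 mulr_sumr; congr (_ + _).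
  by apply: eq_bigr => c _; rewrite normrM ger0_norm.
- move=> N; have -> : trunc N (fun j => lin (map (fun c => a * c) c1 ++ c2) (t1 ++ t2) j - (a * y1 j + y2 j)) =
    (fun j => a * trunc N (fun j => lin c1 t1 j - y1 j) j + trunc N (fun j => lin c2 t2 j - y2 j) j).
    apply: funext => j; rewrite /trunc; case: ifP => _; last by rewrite mulr0 addr0.
    by rewrite lin_cat ?size_map // lin_scale mulrBr opprD addrACA.
  rewrite mulrDl -mulrA.
  apply: le_trans (tnorm_add theta01 Fnil (supp_le_scale _ (@supp_le_trunc R N _)) (@supp_le_trunc R N _)) _.
  apply: lerD (H2 N); apply: le_trans (tnorm_scale theta01 Fnil _ (@supp_le_trunc R N _)) _.
  by rewrite ger0_norm //; exact: ler_wpM2l.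
Qed.

(** [bt] is the stretch of a branch of which [bv] approximates an l1-normalized combination; [wt] is
    the coefficient of [bv] in an average. *)
Record block := Block { wt : R; lo : nat; hi : nat; bv : vec; bt : seq vec }.
Implicit Types (b : block) (L : seq block).

Definition atom (tau B : R) b : Prop :=
  [/\ 0 <= wt b, (0 < lo b <= hi b)%N, supp_in (lo b) (hi b) (bv b), tn (bv b) <= B
    & approx tau 1 (bt b) (bv b)].

Fixpoint separated (tau B : R) (q : nat -> nat) (p : nat) L : Prop :=
  if L is b :: L' then [/\ (p <= lo b)%N, atom tau B b & separated tau B q (q (hi b)) L']
  else True.

Definition hits H b : bool := has (fun h => lo b <= h <= hi b)%N H.
(** The mass to be kept small: when [H] is the set of group minima, a block that is not hit meets at
    most one group. *)
Definition hit L H : R := \sum_(b <- L | hits H b) wt b.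
Definition weight L : R := \sum_(b <- L) wt b.
Definition branch L : seq vec := flatten (map bt L).
Definition comb L : vec := fun i => \sum_(b <- L) wt b * bv b i.
Definition scale_block (a : R) b := Block (a * wt b) (lo b) (hi b) (bv b) (bt b).

Section Systems.
Variables (tau B : R) (q : nat -> nat).
Hypothesis q_gt : forall x, (x < q x)%N.
Notation sep := (separated tau B q).

Lemma sep_end p L : sep p L -> exists p' P, [/\ (p <= p')%N, all (fun b => hi b <= P)%N L
  & forall L', sep p' L' -> sep p (L ++ L')].
Proof.
elim: L p => [|b L IH] p /=; first by exists p, 0%N.
move=> [pb ab /IH[p' [P [qp' aP H]]]]; exists p', (maxn P (hi b)); split.
- apply: leq_trans qp'; apply: leq_trans (ltnW (q_gt _)); apply: leq_trans pb _.
  by case: ab => _ /andP[].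
- rewrite leq_maxr /=; apply: sub_all aP => b' H'; exact: leq_trans (leq_maxl _ _).
- by move=> L' /H.
Qed.

Lemma sep_lo p L : sep p L -> all (fun b => p <= lo b)%N L.
Proof.
elim: L p => [//|b L IH] p /= [pb ab /IH aL]; rewrite pb /=; apply: sub_all aL => b'.
apply: leq_trans; apply: leq_trans (ltnW (q_gt _)); apply: leq_trans pb _.
by case: ab => _ /andP[].
Qed.

Lemma sepW p p' L : (p' <= p)%N -> sep p L -> sep p' L.
Proof. by case: L => [//|b L] pp' /= [pb ? ?]; split=> //; exact: leq_trans pb. Qed.

Lemma sep_scale a p L : 0 <= a -> sep p L -> sep p (map (scale_block a) L).
Proof.
move=> a0; elim: L p => [//|b L IH] p /= [pb [w0 ? ? ? ?] /IH H]; split=> //.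
by split=> //=; exact: mulr_ge0.
Qed.

Lemma branch_scale a L : branch (map (scale_block a) L) = branch L.
Proof. by rewrite /branch -map_comp. Qed.

Lemma hit_scale a L H : hit (map (scale_block a) L) H = a * hit L H.
Proof. by rewrite /hit big_map mulr_sumr. Qed.

Lemma weight_scale a L : weight (map (scale_block a) L) = a * weight L.
Proof. by rewrite /weight big_map mulr_sumr. Qed.

Lemma hit_cons b L H : hit (b :: L) H = (if hits H b then wt b else 0) + hit L H.
Proof. by rewrite /hit big_cons; case: ifP; rewrite ?add0r. Qed.

Lemma hit_ge0 p L H : sep p L -> 0 <= hit L H.
Proof.
elim: L p => [|b L IH] p; first by rewrite /hit big_nil.
move=> /= [_ [w0 _ _ _ _] /IH H0]; rewrite hit_cons addr_ge0 //.
by case: ifP.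
Qed.

Lemma hit_le_weight p L H : sep p L -> hit L H <= weight L.
Proof.
elim: L p => [|b L IH] p; first by rewrite /hit /weight !big_nil.
move=> /= [_ [w0 _ _ _ _] /IH H0]; rewrite hit_cons /weight big_cons lerD //.
by case: ifP.
Qed.

Lemma hit_cat L L' H : hit (L ++ L') H = hit L H + hit L' H.
Proof. by rewrite /hit big_cat. Qed.

Lemma hit_subadd p L H H' : sep p L -> hit L (H ++ H') <= hit L H + hit L H'.
Proof.
elim: L p => [|b L IH] p; first by rewrite /hit !big_nil addr0.
move=> /= [_ [w0 _ _ _ _] /IH H0]; rewrite !hit_cons addrACA lerD //.
rewrite /hits has_cat; do 2!case: has; rewrite ?addr0 ?add0r ?lexx //=.
by rewrite lerDl.
Qed.

Lemma hit_mono p L H H' : sep p L -> (forall b, (p <= lo b)%N -> hits H b -> hits H' b) ->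
  hit L H <= hit L H'.
Proof.
move=> sL HH; have aL := sep_lo sL; elim: L {-2}p sL aL => [|b L IH] r.
  by rewrite /hit !big_nil.
move=> /= [_ [w0 _ _ _ _] /IH H0] /andP[pb /H0 H1]; rewrite !hit_cons lerD //.
by case: ifP => [/HH ->|_] //; case: ifP.
Qed.

Lemma hit_head L H P : fin H -> all (fun b => hi b <= P)%N L ->
  hit L H = 0 \/ (head 0%N H <= P)%N.
Proof.
move=> fH; elim: L => [_|b L IH /= /andP[bP /IH[E|]]]; try by [left; rewrite /hit big_nil|right].
rewrite hit_cons E; case: ifP => [/hasP[h hH /andP[_ hb]]|_]; last by left; rewrite addr0.
by right; apply: leq_trans (head_le fH hH) (leq_trans hb bP).
Qed.

Variable T : seq vec -> Prop.

(** Quantifying over all [U] inside [T] permits application to derived trees, so that blocks can be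
    chained along one branch; [p] pushes them to the right. *)
Definition achieve (c : Ord) (B' : R) : Prop := forall U s p, (forall t, U t -> T t) ->
  dtree U c s -> exists b, [/\ wt b = 1, (p <= lo b)%N, atom tau B' b & U (s ++ bt b)].

Definition small (c : Ord) (A : fam) : Prop := forall eta U s p, 0 < eta ->
  (forall t, U t -> T t) -> dtree U c s ->
  exists L, [/\ sep p L, U (s ++ branch L), weight L = 1 & forall H, A H -> hit L H <= eta].

Lemma small_le c c' A : ole c c' -> small c A -> small c' A.
Proof. by move=> cc' H eta U s p e0 UT /(dtree_le cc'); exact: H. Qed.

Lemma small_sub c A A' : (forall H, A' H -> A H) -> small c A -> small c A'.
Proof.
move=> AA' H eta U s p e0 UT /(H eta U s p e0 UT)[L [? ? ? HL]].
by exists L; split=> // G /AA'/HL.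
Qed.

(* Averaging n consecutive systems: only the first one that meets [H] can have a
   large intersection with it. *)
Lemma small_average k A : (forall H, A H -> fin H) ->
  (forall P, small (oexp k) (fun H => A H /\ (head 0%N H <= P)%N)) ->
  small (oexp (OS k)) A.
Proof.
move=> Afin HA.
have sums n : forall eta U s p P, 0 < eta -> (forall t, U t -> T t) ->
  dtree U (omul (oexp k) (onat n)) s ->
  exists L, [/\ sep p L, U (s ++ branch L), weight L = n%:R,
    forall H, A H -> (head 0%N H <= P)%N -> hit L H <= n%:R * eta
    & forall H, A H -> hit L H <= 1 + n%:R * eta].
  elim: n => [|n IH] eta U s p P e0 UT /=.
    move=> Us; exists [::]; split=> //; rewrite ?cats0 /weight ?big_nil //.
    - by move=> H _ _; rewrite /hit big_nil mul0r.
    - by move=> H _; rewrite /hit big_nil mul0r addr0.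
  rewrite dtree_add => /(HA P eta _ s p e0)[t /dtree_root/UT //|L1 [sL1 UL1 w1 H1]].
  have [p' [P' [pp' aP' cat]]] := sep_end sL1.
  (* [P'] bounds the first system, so a set meeting it has minimum at most [P'] and small mass on
     all later systems. *)
  have [L2 [sL2 UL2 w2 H2 H2']] := IH eta U _ p' (maxn P P') e0 UT UL1.
  exists (L1 ++ L2); split.
  - exact: cat.
  - by rewrite /branch map_cat flatten_cat catA.
  - by rewrite /weight big_cat /= -!/(weight _) w1 w2 mulrS.
  - move=> H AH HP; rewrite hit_cat mulrS mulrDl mul1r lerD ?H1 ?H2 //.
    by rewrite (leq_trans HP) // leq_maxl.
  - move=> H AH; rewrite hit_cat mulrS mulrDl mul1r.
    case: (hit_head (Afin H AH) aP') => [->|HP].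
      rewrite add0r (le_trans (H2' H AH)) // lerD2l lerDr; exact: ltW.
    rewrite lerD //; first by rewrite -w1; exact: hit_le_weight sL1.
    rewrite (le_trans (H2 H AH _)) ?(leq_trans HP) ?leq_maxr //.
    by rewrite lerDr ltW.
move=> eta U s p e0 UT Us.
have e2 : 0 < eta / 2 by rewrite divr_gt0.
(* With [1/n <= eta/2], the average [(1 + n eta/2) / n] is at most [eta]. *)
have [n n0 n1] : exists2 n : nat, 0 < n%:R :> R & n%:R^-1 <= eta / 2.
  exists (Num.Def.archi_bound ((eta / 2)^-1)).+1; first by rewrite ltr0n.
  rewrite -[leRHS]invrK lef_pV2 ?posrE ?invr_gt0 // ?ltr0n //.
  have := archi_boundP (_ : 0 <= (eta / 2)^-1); rewrite invr_ge0 (ltW e2) => /(_ isT)/ltW H.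
  by rewrite (le_trans H) // ler_nat.
have [L [sL UL wL _ HL]] := sums n (eta / 2) U s p 0%N e2 UT (Us n).
have ni0 : 0 <= n%:R^-1 :> R by rewrite invr_ge0 ltW.
exists (map (scale_block n%:R^-1) L); split.
- exact: sep_scale.
- by rewrite branch_scale.
- by rewrite weight_scale wL mulVf // gt_eqF.
- move=> H AH; rewrite hit_scale.
  apply: le_trans (ler_wpM2l ni0 (HL H AH)) _.
  rewrite mulrDr mulr1 mulKf ?gt_eqF //.
  by rewrite [leRHS]splitr lerD.
Qed.

(** Each step of [delta] costs one averaging, and averaging needs only sets with minimum at most
    some [P]. This bounds the number of pieces at a successor and the index of the approximating
    family at a limit. *)
Lemma small_schreier g delta : achieve (oexp g) B -> small (oexp (OS (oadd g delta))) (S delta).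
Proof.
move=> Hg; elim/(S_ind Hfs HS): delta => [a b e||a IH|a h la hm hlt hle HF IH].
- move=> IH; apply: small_sub (small_le _ IH) => [H|]; first exact: (S_eq HS e).
  by apply: oexp_le; apply: ole_succ; apply: oadd_lel; case: e.
- apply: small_average => [|P eta U s p e0 UT Us]; first exact: (S_fin Hfs HS).
  (* A single block starting after [P] is missed by every singleton up to [P]. *)
  have [b [b1 pb ab Ub]] := Hg U s (maxn p P.+1) UT Us.
  exists [:: b]; split=> //=.
  + by split=> //; exact: leq_trans (leq_maxl _ _) pb.
  + by rewrite /branch /= cats0.
  + by rewrite /weight big_seq1.
  + move=> H [/(S_zero HS) HH HP]; rewrite hit_cons /hit big_nil addr0.
    case: ifP => [|_]; last exact: ltW.
    case: HH HP => [->//|[n [_ ->]]] /= nP; rewrite /hits /= orbF => /andP[bn _].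
    have := leq_trans (leq_trans (leq_maxr p P.+1) pb) bn.
    by rewrite ltnNge nP.
- apply: small_average => [|P eta U s p e0 UT Us]; first exact: (S_fin Hfs HS).
  (* A set of [S (OS a)] with minimum at most [P] is a union of at most [P] sets of [S a], each
     allowed the mass [eta / (P + 1)]. *)
  have e1 : 0 < eta / P.+1%:R by rewrite divr_gt0 // ltr0n.
  have [L [sL UL wL HL]] := IH _ U s p e1 UT Us; exists L; split=> // H [].
  move=> /(S_succ HS)[Fs [sF cF eF [_ szF]]] HP.
  have szP : (size Fs <= P)%N.
    rewrite size_map in szF; apply: leq_trans szF (leq_trans _ HP).
    by rewrite eF; move/successiveP: sF => /andP[]; case: (Fs) => [//|[//|]].
  have : hit L H <= (size Fs)%:R * (eta / P.+1%:R).
    rewrite eF; elim: (Fs) cF => [|A Fs' IHF] cF /=.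
      by rewrite mul0r /hit big1.
    apply: le_trans (hit_subadd _ _ sL) _; rewrite mulrS mulrDl mul1r lerD //.
      by apply: HL; apply: cF; rewrite mem_head.
    by apply: IHF => A' A'F; apply: cF; rewrite inE A'F orbT.
  move/le_trans; apply; rewrite mulrCA -[leRHS]mulr1; apply: ler_wpM2l; first exact: ltW.
  by rewrite ler_pdivrMr ?ltr0n // mul1r ler_nat (leq_trans szP).
- apply: small_average => [|P eta U s p e0 UT Us]; first exact: (S_fin Hfs HS).
  have hmono n m : (n <= m)%N -> ole (h n) (h m).
    elim: m => [|m IHm]; first by rewrite leqn0 => /eqP ->; exact: ole_refl.
    rewrite leq_eqVlt => /predU1P[->|/IHm H]; [exact: ole_refl|exact: ole_trans H (hm m)].
  (* Only the terms [h n] with [n <= P] matter, and beyond a common [N] their families lie in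
     [S (h P)]. *)
  have [N HN] : exists N, forall n F, (n <= P)%N -> S (h n) F -> (N <= head 0%N F)%N -> S (h P) F.
    have [N HN] : exists N : nat -> nat, forall n F, (n <= P)%N -> S (h n) F ->
        (N n <= head 0%N F)%N -> S (h P) F.
      suff /choice[N HN] : forall n, exists k, (n <= P)%N ->
          forall F, S (h n) F -> (k <= head 0%N F)%N -> S (h P) F.
        by exists N => n F nP; exact: HN.
      move=> n; case: (leqP n P) => [/hmono/(S_tail Hfs HS)[k Hk]|_]; last by exists 0%N.
      by exists k.
    exists (\max_(n < P.+1) N n) => n F nP SF H; apply: (HN n) => //.
    apply: leq_trans H; exact: (leq_bigmax (Ordinal (nP : (n < P.+1)%N))).
  have Hle : ole (oexp (OS (oadd g (h P)))) (oexp (oadd g a)).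
    by apply: oexp_le; apply: oadd_lt.
  have [L [sL UL wL HL]] := IH (h P) (hlt P) eta U s (maxn p N) e0 UT (dtree_le Hle Us).
  exists L; split=> //; first by apply: sepW sL; exact: leq_maxl.
  (* The blocks start at or after [N], so dropping the elements of [H] below [N] loses no hits. *)
  move=> H [/HF HH HP]; pose k := find (fun n => N <= n)%N H.
  have HN' : S (h P) (drop k H).
    case E : (drop k H) => [|x H']; first exact: S_nil Hfs HS _.
    case: HH => [H0|[H0 [n [/andP[n1 nH] SH]]]]; first by rewrite H0 in E.
    rewrite -E; apply: (HN n); first exact: leq_trans nH HP.
      exact: (S_drop Hfs HS).
    rewrite E /=; have kH : (k < size H)%N by rewrite ltnNge; apply/negP => /drop_oversize; rewrite E.
    have := nth_find 0%N (_ : has (fun n => N <= n)%N H).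
    by rewrite has_find kH => /(_ isT); rewrite -/k -[k]addn0 -nth_drop E.
  apply: le_trans (HL _ HN'); apply: hit_mono sL _ => b.
  rewrite geq_max => /andP[_ Nb]; rewrite /hits -{1}(cat_take_drop k H) has_cat => /orP[|//].
  move=> /hasP[x /(nthP 0%N)[j]]; rewrite size_takel ?find_size // => jk <-.
  rewrite nth_take // => /andP[bx _]; have := before_find 0%N jk.
  by rewrite (leq_trans Nb bx).
Qed.

End Systems.
End Averages.

(** * Norm of an average *)

Section Estimate.
Variables (R : realType) (theta : nat -> R) (beta : nat -> Ord)
  (fs : Ord -> nat -> Ord) (S : Ord -> fam).
Hypotheses (theta01 : forall n, 0 < theta n < 1)
  (theta_mono : forall n, theta n.+1 <= theta n)
  (Hfs : fund_seq fs) (HS : schreier_system fs S).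
Notation vec := (nat -> R).
Notation Fn := (fun n => S (beta n)).
Notation tn := (tnorm theta Fn).
Let Fnil := Fn_nil beta Hfs HS.

(** [delta], [ls] and [Ns] come from the failure of the condition at [e]; [q] comes from the decay
    of [theta] and makes a block negligible for [theta m] when the next one still starts before
    [Ns m]. *)
Variables (e eta : R) (delta : Ord) (ls : nat -> seq nat) (Ns q : nat -> nat).
Hypotheses (e0 : 0 < e) (eta0 : 0 < eta)
  (Hls : forall m, ls m = [::] \/ theta m < e * \prod_(n <- ls m) theta n)
  (HNs : forall m F, S (beta m) F -> (Ns m <= head 0%N F)%N ->
     S (oadd (osum beta (ls m)) delta) F)
  (q_gt : forall x, (x < q x)%N)
  (Hq : forall m P, (q P < Ns m)%N -> theta m * P.+1%:R <= eta).
Variables (tau B : R).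
Hypotheses (B1 : B <= 1).
Notation sep := (separated theta beta S tau B q).
Notation atm := (atom theta beta S tau B).

Lemma supp_in_le lo hi (v : vec) : (0 < lo)%N -> supp_in lo hi v -> supp_le hi v.
Proof.
move=> lo0 Hv i Hi; apply: Hv; apply: contra Hi => /andP[H1 H2].
by rewrite H2 andbT (leq_trans lo0).
Qed.

Lemma atom_supp b : atm b -> supp_le (hi b) (bv b).
Proof. by move=> [_ /andP[lo0 _] Hv _ _]; exact: supp_in_le Hv. Qed.

Lemma sep_comb_supp p L : sep p L -> exists M, supp_le M (comb L).
Proof.
elim: L p => [|b L IH] p /=.
  by move=> _; exists 0%N => i _; rewrite /comb big_nil.
move=> [_ /atom_supp Hb /IH[M HM]]; exists (maxn (hi b) M) => i Hi.
rewrite /comb big_cons (supp_leW (leq_maxl _ M) Hb) // mulr0 add0r.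
exact: (supp_leW (leq_maxr (hi b) _) HM).
Qed.

Definition share m Es (b : block R) : R :=
  theta m * \sum_(E <- Es) tn (restr E (bv b)).

Lemma share_ge0 m Es b : atm b -> 0 <= share m Es b.
Proof.
move=> /atom_supp Hb; apply: mulr_ge0; first exact: ltW (theta_gt0 theta01 m).
by apply: sumr_ge0 => E _; exact: (tnorm_ge0 theta01 Fnil (supp_le_restr E Hb)).
Qed.

Lemma share_le1 m Es b : admissible (Fn m) Es -> atm b -> share m Es b <= 1.
Proof.
move=> aE ab; have [_ _ _ HB _] := ab.
exact: le_trans (tnorm_adm theta01 Fnil (atom_supp ab) aE) (le_trans HB B1).
Qed.

Lemma share_le_hi m Es b : admissible (Fn m) Es -> atm b ->
  share m Es b <= theta m * (hi b).+1%:R.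
Proof.
move=> [sE _] ab; have Hb := atom_supp ab; have [_ _ _ HB _] := ab.
apply: (ler_wpM2l (ltW (theta_gt0 theta01 m))).
apply: le_trans (_ : l1norm (hi b) (bv b) <= _).
  apply: le_trans (l1norm_successive (hi b) (bv b) sE); apply: ler_sum => E _.
  exact: (tnorm_le_l1 theta01 Fnil (supp_le_restr E Hb)).
rewrite /l1norm; apply: le_trans (_ : \sum_(i < (hi b).+1) 1 <= _); last first.
  by rewrite sumr_const card_ord.
apply: ler_sum => i _; apply: le_trans (le_trans HB B1).
exact: (tnorm_coord theta01 Fnil _ Hb).
Qed.

Lemma comb_share p L m Es : sep p L ->
  theta m * \sum_(E <- Es) tn (restr E (comb L)) <= \sum_(b <- L) wt b * share m Es b.
Proof.
elim: L p => [|b L IH] p /=.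
  rewrite big_nil big1 ?mulr0 // => E _.
  rewrite (_ : restr E _ = fun _ => 0) ?tnorm_zero //; apply: funext => i.
  by rewrite /restr /comb big_nil if_same.
move=> [_ ab sL]; have [M HM] := sep_comb_supp sL; have Hb := atom_supp ab.
rewrite big_cons; apply: le_trans (lerD (lexx _) (IH _ sL)).
have HM' := supp_leW (leq_maxr (hi b) M) HM.
have Hb' := supp_leW (leq_maxl (hi b) M) Hb.
rewrite /share mulrCA -mulrDr; apply: (ler_wpM2l (ltW (theta_gt0 theta01 m))).
rewrite mulr_sumr -big_split /=; apply: ler_sum => E _.
have -> : restr E (comb (b :: L)) = (fun i => wt b * restr E (bv b) i + restr E (comb L) i).
  apply: funext => i; rewrite /restr /comb; case: ifP => _; last by rewrite mulr0 addr0.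
  by rewrite big_cons.
apply: le_trans (tnorm_add theta01 Fnil (supp_le_scale _ (supp_le_restr E Hb')) (supp_le_restr E HM')) _.
rewrite lerD2r; apply: le_trans (tnorm_scale theta01 Fnil _ (supp_le_restr E Hb')) _.
by case: ab => w0 _ _ _ _; rewrite ger0_norm.
Qed.

(** A singleton at the left end of a block hits that block. *)
Lemma wt_le_hit p L : sep p L -> (forall i, (0 < i)%N -> hit L [:: i] <= eta) ->
  all (fun b => wt b <= eta) L.
Proof.
elim: L p => [//|b L IH] p /= [pb [w0 /andP[lo0 lohi] _ _ _] sL] HL; apply/andP; split.
  apply: le_trans (HL (lo b) lo0); rewrite hit_cons /hits /= leqnn lohi /= lerDl.
  exact: (hit_ge0 _ sL).
apply: (IH _ sL) => i i0; apply: le_trans (HL i i0); rewrite hit_cons lerDr.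
by case: ifP.
Qed.

(* Only the last block starting before [Ns m] is not negligible for [theta m]. *)
Lemma early_blocks p L m Es : sep p L -> admissible (Fn m) Es ->
  all (fun b => wt b <= eta) L ->
  \sum_(b <- L) (if (lo b < Ns m)%N then wt b * share m Es b else 0) <= eta + eta * weight L.
Proof.
move=> sL aE; elim: L p sL => [|b L IH] p.
  by rewrite /weight !big_nil mulr0 addr0 ltW.
move=> /= [pb ab sL] /andP[web aL]; rewrite /weight !big_cons -/(weight L).
have [w0 _ _ _ _] := ab.
have wL : 0 <= weight L by apply: le_trans (hit_le_weight [::] sL); exact: (hit_ge0 _ sL).
have sh0 := share_ge0 m Es ab; have sh1 := share_le1 aE ab.
case: L => [|b' L'] in IH sL aL wL *.
  rewrite big_nil addr0 /weight big_nil addr0; case: ifP => _.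
    apply: le_trans (_ : eta <= _); last by rewrite lerDl mulr_ge0 // ltW.
    by rewrite -[leRHS]mulr1 ler_pM.
  by rewrite addr_ge0 ?mulr_ge0 // ltW.
have [lb'|lb'] := ltnP (lo b') (Ns m).
  (* The next block is early too, so [q (hi b) < Ns m], and [Hq] with the crude l1 bound gives a
     share of at most [eta]. *)
  have {}IH := IH _ sL aL; rewrite mulrDr addrCA; apply: lerD IH.
  case: ifP => _; last by rewrite mulr_ge0 // ltW.
  rewrite mulrC; apply: ler_wpM2r => //; apply: le_trans (share_le_hi aE ab) _.
  by apply: Hq; apply: leq_ltn_trans lb'; case: sL.
(* No later block is early; only [b] may contribute, and its weight is at most [eta]. *)
have -> : \sum_(j <- b' :: L') (if (lo j < Ns m)%N then wt j * share m Es j else 0) = 0.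
  have : all (fun b => lo b' <= lo b)%N (b' :: L').
    apply: (sep_lo (tau := tau) (B := B) (theta := theta) (beta := beta) (S := S) q_gt).
    by case: sL => ? ? ?; split.
  elim: (b' :: L') => [|c L IHL]; first by rewrite big_nil.
  by move=> /= /andP[bc /IHL H]; rewrite big_cons H addr0 ltnNge (leq_trans lb' bc).
rewrite addr0; case: ifP => _; last by rewrite addr_ge0 ?mulr_ge0 ?addr_ge0 // ltW.
apply: le_trans (_ : eta <= _); last by rewrite lerDl mulr_ge0 ?addr_ge0 // ltW.
by rewrite -[leRHS]mulr1 ler_pM.
Qed.

(** Two of the three [eta] pay for early blocks and one for blocks hit by the group minima;
    [group_bound] covers the others. Single coordinates are bounded through the hits of
    singletons. *)
Lemma comb_norm p L : sep p L -> weight L = 1 ->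
  (forall H, S delta H -> hit L H <= eta) ->
  tn (comb L) <= 3 * eta + Num.max e (theta 0%N * B).
Proof.
move=> sL wL HL; have [M HM] := sep_comb_supp sL.
have e3 : eta <= 3 * eta by rewrite ler_peMl ?ler1n // ltW.
have m0 : 0 <= Num.max e (theta 0%N * B) by rewrite le_max ltW.
have H1 i : (0 < i)%N -> hit L [:: i] <= eta by move=> i0; apply: HL; exact: (S_single Hfs HS).
apply: (tnorm_le theta01 Fnil HM) => [i|m Es aE].
  apply: le_trans (_ : eta <= _); last by rewrite (le_trans e3) // lerDl.
  case: (posnP i) => [->|i0].
    by rewrite HM // normr0 ltW.
  apply: le_trans (H1 i i0); elim: L p sL {wL HL HM H1} => [|b L IH] p.
    by rewrite /comb /hit !big_nil normr0.
  move=> /= [_ ab sL]; have [w0 lh Hv HB _] := ab.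
  rewrite /comb big_cons; apply: le_trans (ler_normD _ _) _.
  rewrite hit_cons; apply: lerD (IH _ sL).
  rewrite normrM ger0_norm // /hits /= orbF; case: ifPn => [_|/Hv ->]; last by rewrite normr0 mulr0.
  rewrite -[leRHS]mulr1; apply: ler_wpM2l => //; apply: le_trans (le_trans HB B1).
  exact: (tnorm_coord theta01 Fnil _ (atom_supp ab)).
have [H SH HH] := group_bound theta01 theta_mono Hfs HS e0 (Hls m) (@HNs m) aE.
apply: le_trans (comb_share m Es sL) _.
have eb := early_blocks sL aE (wt_le_hit sL H1).
rewrite wL mulr1 in eb.
apply: le_trans (_ : \sum_(b <- L) (if (lo b < Ns m)%N then wt b * share m Es b else 0)
   + (hit L H + weight L * Num.max e (theta 0%N * B)) <= _); last first.
  rewrite wL mul1r addrA lerD2r (_ : 3 * eta = eta + eta + eta) ?lerD ?HL //.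
  by ring.
elim: L p sL {wL HL HM H1 eb} => [|b L IH] p.
  by rewrite /hit /weight !big_nil mul0r !addr0.
move=> /= [_ ab sL]; have [w0 /andP[lo0 lohi] Hv HB _] := ab.
rewrite !big_cons hit_cons /weight big_cons -/(weight L) mulrDl.
set X := (X in _ <= X).
have -> : X = ((if (lo b < Ns m)%N then wt b * share m Es b else 0) +
   ((if hits H b then wt b else 0) + wt b * Num.max e (theta 0%N * B))) +
  (\sum_(b <- L) (if (lo b < Ns m)%N then wt b * share m Es b else 0)
   + (hit L H + weight L * Num.max e (theta 0%N * B))).
  by rewrite /X [X in _ + X = _]addrACA [LHS]addrACA.
apply: lerD (IH _ sL).
have sh0 := share_ge0 m Es ab; have sh1 := share_le1 aE ab.
case: ltnP => lN.
  by rewrite lerDl addr_ge0 ?mulr_ge0 //; case: ifP.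
rewrite add0r; case: ifPn => hb.
  apply: le_trans (_ : wt b <= _); last by rewrite lerDl mulr_ge0.
  by rewrite -[leRHS]mulr1 ler_wpM2l.
rewrite add0r ler_wpM2l //; exact: (HH (lo b) (hi b)).
Qed.

Lemma comb_approx p L : sep p L -> approx theta beta S tau (weight L) (branch L) (comb L).
Proof.
elim: L p => [|b L IH] p /=.
  move=> _; rewrite /weight big_nil (_ : comb _ = fun _ => 0); first exact: approx_nil Hfs HS tau.
  by apply: funext => i; rewrite /comb big_nil.
move=> [_ [w0 _ _ _ Hb] /IH H]; rewrite /weight big_cons -[wt b]mulr1.
rewrite (_ : comb _ = fun i => wt b * bv b i + comb L i).
  exact: (approx_cat theta01 Hfs HS w0 Hb H).
by apply: funext => i; rewrite /comb big_cons.
Qed.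

Lemma comb_supp_in p L P : sep p L -> all (fun b => hi b <= P)%N L -> supp_in p P (comb L).
Proof.
move=> sL aP i Hi; have aL := sep_lo q_gt sL; rewrite /comb.
elim: L {-2}p sL aP aL => [|b L IH] r; first by rewrite big_nil.
move=> /= [_ [_ _ Hv _ _] sL] /andP[bP aP] /andP[pb aL].
rewrite big_cons (IH _ sL) // addr0 Hv ?mulr0 //; apply: contra Hi => /andP[H1 H2].
by rewrite (leq_trans pb H1) (leq_trans H2 bP).
Qed.

Lemma achieve_step T g : achieve theta beta S tau T (oexp g) B ->
  achieve theta beta S tau T (oexp (OS (oadd g delta))) (3 * eta + Num.max e (theta 0%N * B)).
Proof.
move=> Hg U s p UT Us.
have [L [sL UL wL HL]] :=
  small_schreier Hfs HS q_gt (delta := delta) Hg (maxn p 1) eta0 UT Us.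
have [p' [P [_ aP _]]] := sep_end q_gt sL.
exists (Block 1 (maxn p 1) (maxn (maxn p 1) P) (comb L) (branch L)).
split=> //=; first exact: leq_maxl.
split=> //=.
- by rewrite leq_maxl andbT leq_maxr.
- move=> i; rewrite negb_and => Hi; apply: (comb_supp_in sL aP).
  by rewrite negb_and; case/orP: Hi => [->//|]; rewrite leq_max negb_or => /andP[_ ->]; rewrite orbT.
- exact: comb_norm sL wL HL.
- by rewrite -wL; exact: comb_approx sL.
Qed.

End Estimate.

(** * Consequences of the failure of the condition *)

Lemma bounded_lists_cover (M J : nat) : exists E : seq (seq nat),
  forall l, all (fun n => n < M)%N l -> (size l <= J)%N -> l \in E.
Proof.
elim: J => [|J [E HE]]; first by exists [:: [::]] => -[|].
exists ([::] :: [seq n :: l | n <- iota 0 M, l <- E]) => -[|n l] //= /andP[nM aM] sz.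
rewrite inE /=; apply/allpairsP; exists (n, l); split=> //=; last exact: HE.
by rewrite mem_iota.
Qed.

Lemma list_argmax (f : seq nat -> Ord) (P : seq nat -> Prop) (E : seq (seq nat)) :
  (exists l, P l) -> (forall l, P l -> l \in E) ->
  exists l, P l /\ forall l', P l' -> ole (f l') (f l).
Proof.
elim: E P => [|x E IH] P [l Pl] HE; first by have := HE l Pl.
case: (pselect (exists l, P l /\ l <> x)) => [[l1 [P1 l1x]]|H]; last first.
  exists l; split=> // l' Pl'.
  have H' k : P k -> k = x by move=> Pk; case: (pselect (k = x)) => // kx; case: H; exists k.
  by rewrite (H' l') // (H' l) //; exact: ole_refl.
have [|k [Pk kx] /=|l2 [[P2 l2x] H2]] := IH (fun l => P l /\ l <> x).
- by exists l1.
- by move/HE: Pk; rewrite inE => /predU1P[].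
case: (pselect (P x /\ ole (f l2) (f x))) => [[Px Hx]|Hx].
  exists x; split=> // l' Pl'; case: (pselect (l' = x)) => [->|l'x]; first exact: ole_refl.
  by apply: ole_trans Hx; apply: H2.
exists l2; split=> // l' Pl'; case: (pselect (l' = x)) => [e|l'x]; last exact: H2.
case: (ole_or_olt (f l') (f l2)) => // /olt_le H; case: Hx; by rewrite -e.
Qed.

Section Gamma.
Variables (R : realType) (theta : nat -> R) (beta : nat -> Ord) (xi : Ord)
  (fs : Ord -> nat -> Ord) (S : Ord -> fam).
Hypotheses (theta01 : forall n, 0 < theta n < 1)
  (theta_mono : forall n, theta n.+1 <= theta n)
  (theta_null : forall e : R, 0 < e -> exists N, forall n, (N <= n)%N -> theta n < e)
  (xi0 : olt OZ xi)
  (Hfs : fund_seq fs) (HS : schreier_system fs S)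
  (Hdag : ~ dagger theta beta xi).

Lemma power_null (r : R) : 0 < r < 1 -> forall e, 0 < e -> exists J, r ^+ J < e.
Proof.
move=> /andP[r0 r1] e e0.
(* Bernoulli type: [1 - r^n] is [1 - r] times a sum of [n] powers, each at least [r^n]. *)
have H n : (1 - r) * n%:R * r ^+ n <= 1 - r ^+ n.
  elim: n => [|n IH]; first by rewrite mulr0 mul0r expr0 subrr.
  have rn0 : 0 <= r ^+ n by rewrite exprn_ge0 // ltW.
  have nn : 0 <= n%:R :> R by rewrite ler0n.
  rewrite exprS -natr1.
  have H1 : (1 - r) * n%:R * (r * r ^+ n) <= (1 - r) * n%:R * r ^+ n.
    by apply: ler_wpM2l; [rewrite mulr_ge0 // subr_ge0 ltW|rewrite ler_piMl // ltW].
  have H2 : (1 - r) * (r * r ^+ n) <= (1 - r) * r ^+ n.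
    by apply: ler_wpM2l; [rewrite subr_ge0 ltW|rewrite ler_piMl // ltW].
  lra.
have d0 : 0 < (1 - r) * e by rewrite mulr_gt0 // subr_gt0.
pose n := Num.Def.archi_bound (((1 - r) * e)^-1).
have := archi_boundP (_ : 0 <= ((1 - r) * e)^-1); rewrite invr_ge0 (ltW d0) => /(_ isT).
rewrite -/n => nn; exists n; rewrite ltNge; apply/negP => en.
have n1 : 1 < (1 - r) * e * n%:R.
  by move: nn; rewrite -[X in X < _]mul1r ltr_pdivrMr // mulrC.
have := H n; apply/negP; rewrite -ltNge.
apply: lt_le_trans (_ : 1 <= _); first by rewrite ltrBlDr ltrDl exprn_gt0.
apply: le_trans (ltW n1) _; rewrite mulrAC; apply: ler_wpM2l => //.
by rewrite mulr_ge0 ?ler0n // subr_ge0 ltW.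
Qed.

(** Finitely many lists compete: each entry has [theta n > theta m / e], which bounds it, and the
    product is at most [theta 0 ^ size], which bounds the length. *)
Lemma gamma_exists e m : 0 < e -> exists g, gamma_is theta beta e m g.
Proof.
move=> e0; case: (pselect (exists l, gamma_cond theta e m l)) => [[l Hl]|H]; last first.
  exists OZ; right; split; last exact: oeq_refl.
  by move=> l Hl; apply: H; exists l.
have tm : 0 < theta m / e by rewrite divr_gt0 // (theta_gt0 theta01).
have [M HM] := theta_null tm.
have [J HJ] := power_null (theta01 0%N) tm.
have [E HE] := bounded_lists_cover M J.
have prod1 k : \prod_(n <- k) theta n <= 1.
  elim: k => [|n k IH]; first by rewrite big_nil.
  rewrite big_cons mulr_ile1 ?(prod_theta_ge0 theta01) //.
    exact: ltW (theta_gt0 theta01 n).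
  by case/andP: (theta01 n) => _ /ltW.
have [k [Hk kmax]] : exists k, gamma_cond theta e m k /\ forall k', gamma_cond theta e m k' ->
    ole (osum beta k') (osum beta k).
  apply: (@list_argmax _ _ E); first by exists l.
  move=> k [_]; rewrite mulrC -ltr_pdivrMr // => Hk; apply: HE.
    apply/allP => n nk; case/splitPr: nk Hk => k1 k2 Hk.
    rewrite ltnNge; apply/negP => /HM; apply/negP; rewrite -leNgt; apply/ltW.
    apply: lt_le_trans Hk _; rewrite big_cat big_cons /= mulrCA.
    apply: ler_piMr; first exact: ltW (theta_gt0 theta01 n).
    by rewrite mulr_ile1 ?(prod_theta_ge0 theta01).
  rewrite leqNgt; apply/negP => Jk; move: HJ; apply/negP; rewrite -leNgt; apply/ltW.
  apply: lt_le_trans Hk _; apply: le_trans (_ : theta 0%N ^+ size k <= _).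
    elim: k {Jk} => [|n k IH]; first by rewrite big_nil expr0.
    rewrite big_cons exprS ler_pM ?(prod_theta_ge0 theta01) //.
      exact: ltW (theta_gt0 theta01 n).
    exact: theta_le0 theta_mono n.
  case/andP: (theta01 0%N) => /ltW t0 /ltW t1.
  by apply: ler_wiXn2l => //; exact: ltnW.
exists (osum beta k); left; exists k; split=> //; split=> //; exact: oeq_refl.
Qed.

(** If [b] witnesses the failure at [e], then [beta m <= gamma + 2 + b] for all [m]; take
    [delta = 2 + b]. The list [ls m] attains [gamma] or is empty, and [S_tail] turns the inequality
    into inclusion beyond [Ns m]. *)
Lemma not_dagger_tail e : 0 < e -> exists delta, olt delta (oexp xi) /\
  exists (ls : nat -> seq nat) (Ns : nat -> nat),
    (forall m, ls m = [::] \/ theta m < e * \prod_(n <- ls m) theta n) /\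
    (forall m F, S (beta m) F -> (Ns m <= head 0%N F)%N ->
       S (oadd (osum beta (ls m)) delta) F).
Proof.
move=> e0.
have [b [bxi Hb]] : exists b, olt b (oexp xi) /\ forall m g, gamma_is theta beta e m g ->
    ~ olt (oadd (oadd g (onat 2)) b) (beta m).
  apply: contrapT => H; apply: Hdag; exists e; split=> // b bxi.
  apply: contrapT => H'; apply: H; exists b; split=> // m g Hg Hlt.
  by apply: H'; exists m, g.
exists (oadd (onat 2) b); split.
  apply: oexp_add_closed => //; apply: (oexp_limit xi0).2; apply: (oexp_limit xi0).2.
  exact: oexp_gt0.
have /choice[ls Hls] m : exists l, (l = [::] \/ theta m < e * \prod_(n <- l) theta n) /\
    ole (beta m) (oadd (osum beta l) (oadd (onat 2) b)).
  have [g Hg] := gamma_exists m e0; have := not_olt (Hb m g Hg); rewrite oaddA => Hle.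
  case: Hg => [[l [[_ Hl] [gl _]]]|[_ g0]].
    exists l; split; [by right|apply: ole_trans Hle _].
    exact: oadd_ler gl.1.
  by exists [::]; split; [left|exact: ole_trans Hle (oadd_ler _ g0.1)].
have /choice[Ns HNs] m : exists N, forall F, S (beta m) F -> (N <= head 0%N F)%N ->
    S (oadd (osum beta (ls m)) (oadd (onat 2) b)) F.
  exact: (S_tail Hfs HS (Hls m).2).
by exists ls, Ns; split=> [m|m F]; [exact: (Hls m).1|exact: HNs].
Qed.

Lemma spread_exists (Ns : nat -> nat) (eta : R) : 0 < eta -> exists q : nat -> nat,
  (forall x, (x < q x)%N) /\ forall m P, (q P < Ns m)%N -> theta m * P.+1%:R <= eta.
Proof.
move=> eta0; have /choice[M HM] P : exists M, forall m, (M <= m)%N -> theta m < eta / P.+1%:R.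
  by apply: theta_null; rewrite divr_gt0 // ltr0n.
(* [q P] dominates [Ns m] for all [m < M P], so [q P < Ns m] forces [m >= M P], where [theta m] is
   below [eta / (P + 1)]. *)
exists (fun P => (P.+1 + \max_(m < M P) Ns m)%N); split=> [x|m P]; first by rewrite leq_addr.
have [/HM H _|mM] := leqP (M P) m; first by rewrite -ler_pdivlMr ?ltr0n // ltW.
have := leq_bigmax (F := fun i : 'I_(M P) => Ns i) (Ordinal mM) => /= H1 H2.
have := leq_ltn_trans H1 (leq_ltn_trans (leq_addl P.+1 _) H2).
by rewrite ltnn.
Qed.

End Gamma.

(** * The upper bound *)

Section Upper.
Variables (R : realType) (theta : nat -> R) (beta : nat -> Ord) (xi : Ord)
  (fs : Ord -> nat -> Ord) (S : Ord -> fam).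
Hypotheses (theta01 : forall n, 0 < theta n < 1)
  (theta_mono : forall n, theta n.+1 <= theta n)
  (theta_null : forall e : R, 0 < e -> exists N, forall n, (N <= n)%N -> theta n < e)
  (xi0 : olt OZ xi)
  (Hfs : fund_seq fs) (HS : schreier_system fs S)
  (Hdag : ~ dagger theta beta xi).
Notation vec := (nat -> R).
Notation Fn := (fun n => S (beta n)).
Notation tn := (tnorm theta Fn).
Notation Tn := (Tnorm theta Fn).
Notation zv := (fun _ : nat => 0 : R).
Let Fnil := Fn_nil beta Hfs HS.

Lemma lin_nth (cs : seq R) (t : seq vec) j : size cs = size t ->
  lin cs t j = \sum_(i < size t) cs`_i * nth zv t i j.
Proof.
move=> sz; rewrite /lin (big_nth (0, zv)) size_zip sz minnn big_mkord.
by apply: eq_bigr => i _; rewrite nth_zip.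
Qed.

Lemma sum_norm_nth (cs : seq R) n : size cs = n -> \sum_(i < n) `|cs`_i| = \sum_(c <- cs) `|c|.
Proof. by move=> <-; rewrite (big_nth 0) big_mkord. Qed.

Lemma Tnorm_trunc_le x N : Tn x = 1 -> tn (trunc N x) <= 1.
Proof.
move=> x1; rewrite -x1; apply: (sup_upper_bound (E := range (fun N => tn (trunc N x)))); last by exists N.
(* A set without supremum has [sup] equal to 0, so norm 1 forces the truncations to be bounded. *)
apply: contrapT => /sup_out; rewrite -/(Tn x) x1 => /eqP.
by rewrite oner_eq0.
Qed.

(** On [p] coordinates, [p + 1] vectors have a nontrivial relation, read off the kernel of their
    matrix and then normalized. *)
Lemma lin_dependent p (t : seq vec) : size t = p.+1 ->
  exists cs, [/\ size cs = p.+1, \sum_(c <- cs) `|c| = 1 & forall j, (j < p)%N -> lin cs t j = 0].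
Proof.
move=> st; pose A := \matrix_(i < p.+1, j < p) nth zv t i j.
have : kermx A != 0.
  rewrite -mxrank_eq0 mxrank_ker -lt0n subn_gt0.
  exact: leq_ltn_trans (rank_leq_col A) (ltnSn p).
case/rowV0Pn => v /sub_kermxP vA v0.
pose cs0 := [seq v 0 i | i <- enum 'I_p.+1].
have sz0 : size cs0 = p.+1 by rewrite size_map size_enum_ord.
have nth0 (i : 'I_p.+1) : cs0`_i = v 0 i.
  by rewrite (nth_map i) ?size_enum_ord // nth_ord_enum.
pose w := \sum_(c <- cs0) `|c|.
have w0 : 0 < w.
  rewrite lt_neqAle sumr_ge0 // andbT eq_sym; apply: contra v0.
  rewrite /w -(sum_norm_nth sz0) psumr_eq0 // => /allP H.
  apply/eqP/rowP => i; have := H i (mem_index_enum i).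
  by rewrite nth0 normr_eq0 mxE => /eqP.
exists (map (fun c => w^-1 * c) cs0); split.
- by rewrite size_map.
- rewrite big_map; transitivity (\sum_(c <- cs0) w^-1 * `|c|).
    by apply: eq_bigr => c _; rewrite normrM gtr0_norm // invr_gt0.
  by rewrite -mulr_sumr mulVf // gt_eqF.
- move=> j jp; rewrite lin_scale lin_nth ?sz0 // st.
  transitivity (w^-1 * (v *m A) 0 (Ordinal jp)); last by rewrite vA mxE mulr0.
  by rewrite mxE; congr (_ * _); apply: eq_bigr => i _; rewrite nth0 mxE.
Qed.

(** Order [omega] allows an extension by [p + 1] vectors. A normalized combination of them vanishes
    below [p], and cutting it at a large [P] costs at most [tau]. *)
Lemma achieve_base K tau : 0 < tau ->
  achieve theta beta S tau (l1tree theta Fn K) (oexp (onat 1)) 1.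
Proof.
move=> tau0 U s p UT /= /(_ p.+1).
have -> : omul (OS OZ) (onat p.+1) = onat p.+1.
  by elim: (p.+1) => //= n ->.
move=> /dtree_nat[t st Ut].
have tT i : (i < size t)%N -> inT theta Fn (nth zv t i) /\ Tn (nth zv t i) = 1.
  move=> it; have [/(_ (size s + i)%N)] := UT _ Ut.
  by rewrite size_cat ltn_add2l => /(_ it); rewrite nth_cat ltnNge leq_addr /= addKn.
have [cs [scs cs1 cs0]] := lin_dependent st.
have scs' : size cs = size t by rewrite st.
have /choice[Nf HNf] (i : nat) : exists N, (i < size t)%N -> forall k l, (N <= k <= l)%N ->
    tn (fun j => trunc l (nth zv t i) j - trunc k (nth zv t i) j) < tau.
  case: (ltnP i (size t)) => [it|_]; last by exists 0%N.
  by have [[_ /(_ _ tau0)[N HN]] _] := tT i it; exists N.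
pose P := maxn p.+1 (\max_(i < size t) Nf i).
have HP (i : 'I_(size t)) l : (P <= l)%N ->
    tn (fun j => trunc l (nth zv t i) j - trunc P (nth zv t i) j) < tau.
  move=> Pl; apply: HNf => //; rewrite Pl andbT; apply: leq_trans (leq_maxr _ _).
  exact: (leq_bigmax i).
have bnd (v : 'I_(size t) -> vec) (M : nat) (a : R) : (forall i, supp_le M (v i)) ->
    (forall i, tn (v i) <= a) -> 0 <= a -> tn (fun j => \sum_(i < size t) cs`_i * v i j) <= a.
  move=> Hv Ha a0; apply: le_trans (tnorm_sum theta01 Fnil _ _ Hv) _.
  apply: le_trans (_ : \sum_(i < size t) `|cs`_i| * a <= _).
    by apply: ler_sum => i _; apply: ler_wpM2l.
  by rewrite -mulr_suml (sum_norm_nth scs') cs1 mul1r.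
pose y := trunc P (lin cs t).
have yE : y = fun j => \sum_(i < size t) cs`_i * trunc P (nth zv t i) j.
  apply: funext => j; rewrite /y /trunc; case: ifP => _; first exact: lin_nth.
  by rewrite big1 // => i _; rewrite mulr0.
exists (Block 1 (maxn p 1) P y t); split=> //=; first exact: leq_maxl.
split=> //=.
- by rewrite leq_maxr /= geq_max (leq_trans (leqnSn p)) ?leq_maxl //= (leq_trans _ (leq_maxl _ _)).
- move=> i; rewrite /y /trunc; case: (boolP (0 < i <= P)%N) => // /andP[i0 ->].
  rewrite andbT geq_max i0 andbT -ltnNge; exact: cs0.
- rewrite yE; apply: (bnd _ P) => // i; first exact: supp_le_trunc.
  by apply: Tnorm_trunc_le; case: (tT i (ltn_ord i)).
- exists cs; split=> // N; rewrite mul1r.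
  have [NP|PN] := leqP N P.
    rewrite (_ : trunc N _ = fun _ => 0) ?tnorm_zero ?ltW //.
    apply: funext => j; rewrite /y /trunc; case: (boolP (0 < j <= N)%N) => // /andP[j0 jN].
    by rewrite j0 (leq_trans jN NP) subrr.
  have -> : trunc N (fun j => lin cs t j - y j) =
      fun j => \sum_(i < size t) cs`_i * (trunc N (nth zv t i) j - trunc P (nth zv t i) j).
    apply: funext => j; rewrite /y.
    transitivity (trunc N (lin cs t) j - trunc P (lin cs t) j).
      rewrite /trunc; case: (boolP (0 < j <= N)%N) => // jN.
      case: ifP => [/andP[j0 jP]|_]; last by rewrite subrr.
      move: jN.
      by rewrite j0 (leq_trans jP (ltnW PN)).
    have E M : trunc M (lin cs t) j = \sum_(i < size t) cs`_i * trunc M (nth zv t i) j.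
      rewrite /trunc; case: ifP => _; first exact: lin_nth.
      by rewrite big1 // => i _; rewrite mulr0.
    by rewrite !E -sumrB; apply: eq_bigr => i _; rewrite mulrBr.
  apply: (bnd (fun i j => trunc N (nth zv t i) j - trunc P (nth zv t i) j) N); last exact: ltW.
    move=> i j Hj; rewrite {1}/trunc (negbTE Hj) sub0r /trunc; case: ifP => [/andP[j0 jP]|_]; last by rewrite oppr0.
    by move: Hj; rewrite j0 (leq_trans jP (ltnW PN)).
  by move=> i; apply: ltW; apply: HP; exact: ltnW.
Qed.

Lemma achieve_le T tau c B B' : B <= B' ->
  achieve theta beta S tau T c B -> achieve theta beta S tau T c B'.
Proof.
move=> BB' H U s p UT Us; have [b [b1 pb [w0 lh Hv HB Ha] Ub]] := H U s p UT Us.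
by exists b; split=> //; split=> //; exact: le_trans HB BB'.
Qed.

(** Iterates [achieve_step]. The minimum with 1 maintains its hypothesis [B <= 1], and the orders
    stay below [omega^xi], which is a limit closed under addition. *)
Lemma achieve_power T tau e : 0 < e -> e <= 2^-1 ->
  achieve theta beta S tau T (oexp (onat 1)) 1 ->
  forall j, exists g, olt g (oexp xi) /\
    achieve theta beta S tau T (oexp g) (Num.min 1 (2 * e + theta 0%N ^+ j)).
Proof.
move=> e0 e2 H0.
have [delta [dxi [ls [Ns [Hls HNs]]]]] :=
  not_dagger_tail theta01 theta_mono theta_null xi0 Hfs HS Hdag e0.
case/andP: (theta01 0%N) => t0 t1.
(* Then [3 eta = e - theta 0 e], and [3 eta + theta 0 (2 e + theta 0 ^ j) = e + theta 0 e + theta 0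
   ^ (j + 1)] is at most [2 e + theta 0 ^ (j + 1)]. *)
pose eta := e * (1 - theta 0%N) / 3.
have eta0 : 0 < eta by rewrite divr_gt0 // mulr_gt0 // subr_gt0.
have eta3 : 3 * eta = e - theta 0%N * e by rewrite /eta; field.
have [q [q_gt Hq]] := spread_exists theta_null Ns eta0.
have lim := oexp_limit xi0.
have te : theta 0%N * e <= e by rewrite ler_piMl // ltW.
elim=> [|j [g [gxi Hg]]].
  exists (onat 1); split; first exact: lim.2 _ lim.1.
  by apply: achieve_le H0; rewrite expr0 le_min lexx /= lerDr mulr_ge0 // ltW.
exists (OS (oadd g delta)); split; first by apply: lim.2; exact: oexp_add_closed.
have B1 : Num.min 1 (2 * e + theta 0%N ^+ j) <= 1 by rewrite ge_min lexx.
have := achieve_step theta01 theta_mono Hfs HS e0 eta0 Hls HNs q_gt Hq B1 Hg.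
apply: achieve_le; rewrite eta3 -lerBrDl ge_max.
have tj : 0 <= theta 0%N ^+ j.+1 by rewrite exprn_ge0 // ltW.
have te0 : 0 < theta 0%N * e by rewrite mulr_gt0.
have m1 : theta 0%N * Num.min 1 (2 * e + theta 0%N ^+ j) <= theta 0%N.
  by rewrite ler_piMr // ltW.
have m2 : theta 0%N * Num.min 1 (2 * e + theta 0%N ^+ j) <= theta 0%N * (2 * e + theta 0%N ^+ j).
  by rewrite ler_pM2l // ge_min lexx orbT.
have sq : e - theta 0%N * e <= 1 - theta 0%N.
  have -> : e - theta 0%N * e = (1 - theta 0%N) * e by ring.
  by rewrite ler_piMr ?subr_ge0 ?(ltW t1) // (le_trans e2) // invf_le1 ?ler1n.
have e21 : 2 * e <= 1 by rewrite mulrC -ler_pdivlMr // mul1r.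
rewrite lerBrDl lerBrDl !le_min; apply/andP; split; apply/andP; split; try lra.
by move: m2; rewrite mulrDr -exprS => m2; lra.
Qed.

Theorem l1tree_bounded K : 0 < K -> tree_empty (dtree (l1tree theta Fn K) (oexp (oexp xi))).
Proof.
(* The final norm is at most [2 e + theta 0 ^ J + e < 4 e], half of [min 1 K^-1]; the last [e] is
   the approximation error. *)
move=> K0 s Hs; pose e := (Num.min 1 K^-1) / 8.
have m0 : 0 < Num.min 1 K^-1 by rewrite lt_min ltr01 invr_gt0.
have e0 : 0 < e by rewrite divr_gt0.
have m1 : Num.min 1 K^-1 <= 1 by rewrite ge_min lexx.
have mK : Num.min 1 K^-1 <= K^-1 by rewrite ge_min lexx orbT.
have e2 : e <= 2^-1 by rewrite /e; lra.
have [J HJ] := power_null (theta01 0%N) e0.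
have [g [gxi Hg]] := achieve_power e0 e2 (@achieve_base K e e0) J.
have Hs' := dtree_le (oexp_le (olt_le gxi)) Hs.
have [b [b1 _ [_ /andP[lo0 _] Hv HB [cs [scs cs1 Hcs]]] [_ Tb]]] := Hg _ s 0%N (fun t Ht => Ht) Hs'.
(* Zero coefficients on [s] leave only the new stretch, to which the tree assigns norm at least
   [K^-1]. *)
pose a := nseq (size s) 0 ++ cs.
have sza : size a = size (s ++ bt b) by rewrite !size_cat size_nseq scs.
have := Tb (fun i => a`_i).
rewrite (sum_norm_nth sza) big_cat /= cs1 big1_seq; last first.
  by move=> c /andP[_]; rewrite mem_nseq => /andP[_ /eqP ->]; rewrite normr0.
rewrite add0r mulr1; apply/negP; rewrite -ltNge.
have -> : lincomb (fun i => a`_i) (s ++ bt b) = lin cs (bt b).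
  apply: funext => j; rewrite /lincomb -lin_nth // lin_cat ?size_nseq // (_ : lin (nseq _ _) s j = 0) ?add0r //.
  by rewrite lin_nth ?size_nseq // big1 // => i _; rewrite nth_nseq if_same mul0r.
have Hvs := supp_in_le lo0 Hv.
apply: le_lt_trans (_ : 2 * e + theta 0%N ^+ J + e < _); last first.
  by move: HJ mK m0; rewrite /e; lra.
apply: ge_sup; first by exists (tn (trunc 0 (lin cs (bt b)))), 0%N.
move=> _ [N _ <-].
have -> : trunc N (lin cs (bt b)) = fun j => trunc N (fun j => lin cs (bt b) j - bv b j) j + trunc N (bv b) j.
  by apply: funext => j; rewrite /trunc; case: ifP => _; rewrite ?addr0 // subrK.
apply: le_trans (tnorm_add theta01 Fnil (@supp_le_trunc R N _) (@supp_le_trunc R N _)) _.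
rewrite addrC lerD //; last by have := Hcs N; rewrite mul1r.
apply: le_trans (tnorm_trunc theta01 Fnil N Hvs) (le_trans HB _).
by rewrite ge_min lexx orbT.
Qed.

End Upper.

(** * The lower bound *)

Section Lower.
Variables (R : realType) (theta : nat -> R) (beta : nat -> Ord)
  (fs : Ord -> nat -> Ord) (S : Ord -> fam).
Hypotheses (theta01 : forall n, 0 < theta n < 1)
  (Hfs : fund_seq fs) (HS : schreier_system fs S).
Notation vec := (nat -> R).
Notation Fn := (fun n => S (beta n)).
Notation tn := (tnorm theta Fn).
Notation Tn := (Tnorm theta Fn).
Notation zv := (fun _ : nat => 0 : R).
Let Fnil := Fn_nil beta Hfs HS.

(** Induction on [a] for all [V] and [N] at once: successors apply the hypothesis to derived trees
    of [V], with [N] placing each set after the previous one. *)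
Lemma schreier_rank a (x : nat -> vec) V s N :
  (forall F, S a F -> (F <> [::] -> (N < head 0%N F)%N) -> V (s ++ map x F)) ->
  dtree V (oexp a) s.
Proof.
elim/(S_ind Hfs HS): a V s N => [a b e|V s N HV|a IH|a h la hm hlt hle HF IH V s N HV].
- move=> IH V s N HV; apply: dtree_le (oexp_le e.1) _; apply: (IH V s N) => F Fb.
  by apply: HV; exact: (S_eq HS (oeq_sym e)).
- split; first by have := HV [::]; rewrite cats0; apply=> //; exact: S_nil Hfs HS _.
  exists (x N.+1); have := HV [:: N.+1]; rewrite cats1 /=; apply=> //.
  exact: (S_single Hfs HS).
- have blocks n V s N : (forall Fs, successive Fs -> (size Fs <= n)%N ->
        (forall F, F \in Fs -> S a F) -> (Fs <> [::] -> (N < head 0%N (flatten Fs))%N) ->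
        V (s ++ map x (flatten Fs))) ->
      dtree V (omul (oexp a) (onat n)) s.
    elim: n V s N => [|n IHn] V s N HV.
      by have := HV [::]; rewrite cats0; apply.
    rewrite dtree_add; apply: (IH _ s N) => F SF NF.
    have fF := S_fin Hfs HS SF.
    case: F SF NF fF => [|y F] SF NF fF.
      by rewrite cats0; apply: (IHn _ _ N) => Fs sF szF; apply: HV => //; exact: ltnW.
    apply: (IHn _ _ (\max_(i <- y :: F) i)) => Fs sF szF cF NFs.
    rewrite -catA -map_cat; apply: (HV ((y :: F) :: Fs)) => //.
    + move/successiveP: sF => /andP[aF fF']; apply/successiveP; rewrite [all _ _]/= aF.
      rewrite [flatten _]/= -cat_cons fin_catE fF fF' !andbT.
      apply/allrelP => i j iF jF; have Fs0 : Fs <> [::] by move=> Fs0; rewrite Fs0 in jF.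
      apply: leq_trans (head_le fF' jF); apply: leq_ltn_trans (NFs Fs0).
      by rewrite (leq_bigmax_seq (P := xpredT) (F := id)).
    + by move=> G; rewrite inE => /predU1P[->|/cF].
    + by move=> _; exact: NF.
  (* Starting beyond [n] puts a union of at most [n] successive sets of [S a] into [S (OS a)]. *)
  move=> V s N HV n; apply: (blocks n V s (maxn N n)) => Fs sF szF cF NF.
  apply: HV; last first.
    by case: Fs sF szF cF NF => [//|E Fs] _ _ _ NF _; apply: leq_ltn_trans (NF _) => //; exact: leq_maxl.
  apply/(S_succ HS); exists Fs; split=> //; split; first exact: fin_heads.
  rewrite size_map; case: Fs sF szF cF NF => [//|E Fs] sF szF cF NF.
  rewrite [head _ _]/=; apply: leq_trans szF _.
  have E0 : E != [::] by move/successiveP: sF => /andP[/= /andP[]].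
  have := NF (fun H => ltac:(discriminate H)).
  case: (E) E0 => [//|y E'] _ /=; apply: leq_trans.
  exact: leq_trans (leq_maxr N n) (leqnSn _).
(* Beyond [n + 1], sets of [S (h n.+1)] belong to [S a]; the shift keeps the index positive. *)
- apply: dtree_le (oexp_le hle) _ => n; apply: dtree_le (oexp_le (hm n)) _.
  apply: (IH (h n.+1) (hlt n.+1) V s (maxn N n.+1)) => F SF NF; apply: HV.
    apply/HF; case: F SF NF => [|y F] SF NF; [by left|right; split=> //].
    exists n.+1; split=> //=; apply: leq_trans (leq_maxr N n.+1) (ltnW _).
    exact: NF.
  by move=> F0; apply: leq_ltn_trans (NF F0); exact: leq_maxl.
Qed.

Definition unit_vec (k : nat) : vec := fun j => (j == k)%:R.

Lemma unit_vec_supp k : (0 < k)%N -> supp_le k (unit_vec k).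
Proof. by move=> k0 i; rewrite /unit_vec; case: eqP => // ->; rewrite k0 leqnn. Qed.

Lemma Tnorm_ge x M : supp_le M x -> tn x <= Tn x.
Proof.
move=> Hx; rewrite -{1}(trunc_id Hx (leqnn M)).
apply: (ub_le_sup (E := range (fun N => tn (trunc N x)))); last by exists M.
by exists (tn x) => _ [N _ <-]; exact: (tnorm_trunc theta01 Fnil N Hx).
Qed.

Lemma Tnorm_le x M : supp_le M x -> Tn x <= tn x.
Proof.
move=> Hx; apply: ge_sup; first by exists (tn (trunc 0 x)), 0%N.
by move=> _ [N _ <-]; exact: (tnorm_trunc theta01 Fnil N Hx).
Qed.

Lemma unit_vec_inT k : (0 < k)%N -> inT theta Fn (unit_vec k) /\ Tn (unit_vec k) = 1.
Proof.
move=> k0; have Hk := unit_vec_supp k0; split; [split|].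
- by rewrite /unit_vec; case: (k) k0.
- move=> e e0; exists k => p q /andP[kp pq].
  rewrite (trunc_id Hk kp) (trunc_id Hk (leq_trans kp pq)).
  rewrite (_ : (fun i => _) = fun _ => 0) ?tnorm_zero //.
  by apply: funext => i; rewrite subrr.
apply/eqP; rewrite eq_le; apply/andP; split.
  apply: le_trans (Tnorm_le Hk) _; apply: le_trans (tnorm_le_l1 theta01 Fnil Hk) _.
  rewrite /l1norm (bigD1 ord_max) //= big1 ?addr0 => [|i ik].
    by rewrite /unit_vec eqxx normr1.
  by rewrite /unit_vec (_ : (i == k :> nat) = false) ?normr0 //; apply/negbTE.
apply: le_trans (Tnorm_ge Hk).
by have := tnorm_coord theta01 Fnil k Hk; rewrite /unit_vec eqxx normr1.
Qed.

(** The singletons of [F] form an admissible sequence for [beta n], whence the constant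
    [1 / theta n]. *)
Lemma l1tree_unit_vec n F : S (beta n) F -> l1tree theta Fn (theta n)^-1 (map unit_vec F).
Proof.
move=> SF; have fF := S_fin Hfs HS SF; have uF := fin_uniq fF.
split=> [i|a].
  rewrite size_map => iF; rewrite (nth_map 0%N) //; apply: unit_vec_inT.
  by apply: (fin_gt0 fF); rewrite mem_nth.
rewrite invrK size_map; set z := lincomb a _.
have zE j : z j = \sum_(i < size F) a i * unit_vec (nth 0%N F i) j.
  rewrite /z /lincomb size_map; apply: eq_bigr => i _.
  by rewrite (nth_map 0%N).
have zF (i : 'I_(size F)) : z (nth 0%N F i) = a i.
  rewrite zE (bigD1 i) //= /unit_vec eqxx mulr1 big1 ?addr0 // => k ki.
  by rewrite nth_uniq // (_ : (i == k :> nat) = false) ?mulr0 //; apply/negbTE; rewrite eq_sym.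
have Hz : supp_le (\max_(i <- F) i) z.
  move=> j Hj; rewrite zE big1 // => i _; rewrite /unit_vec; case: eqP => [jE|_]; last by rewrite mulr0.
  case/negP: Hj; have jF : j \in F by rewrite jE mem_nth.
  by rewrite (fin_gt0 fF jF) (leq_bigmax_seq (P := xpredT) (F := id)).
apply: le_trans (Tnorm_ge Hz).
have aF : admissible (Fn n) (map (fun x => [:: x]) F).
  split; last by rewrite -map_comp map_id.
  by apply/successiveP; rewrite flatten_seq1 fF andbT; apply/allP => E /mapP[x _ ->].
apply: le_trans (tnorm_adm theta01 Fnil Hz aF); rewrite big_map (big_nth 0%N) big_mkord.
apply: ler_wpM2l; first exact: ltW (theta_gt0 theta01 n).
apply: ler_sum => i _; rewrite -zF.
have := tnorm_coord theta01 Fnil (nth 0%N F i) (supp_le_restr [:: nth 0%N F i] Hz).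
by rewrite {1}/restr mem_head.
Qed.

Lemma l1tree_spreading A x : l1_spreading theta Fn A x -> (forall F, A F -> fin F) ->
  exists2 K : R, 0 < K & forall F, A F -> l1tree theta Fn K (map x F).
Proof.
move=> [xT [K [K0 HK]]] Afin; exists K => // F AF; split=> [i|a].
  by rewrite size_map => iF; rewrite (nth_map 0%N).
have uF := fin_uniq (Afin F AF).
have := HK F (fun n => a (index n F)) AF.
rewrite size_map (big_nth 0%N) big_mkord.
rewrite (_ : (fun j => _) = lincomb a (map x F)).
  congr (_ * _ <= _); apply: eq_bigr => i _; by rewrite index_uniq.
apply: funext => j; rewrite /lincomb size_map (big_nth 0%N) big_mkord.
by apply: eq_bigr => i _; rewrite index_uniq // (nth_map 0%N).
Qed.

End Lower.

Theorem theorem15 (R : realType) (theta : nat -> R) (xi : Ord) (beta : nat -> Ord)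
    (fs : Ord -> nat -> Ord) (S : Ord -> fam) :
  (forall n, 0 < theta n < 1) ->
  (forall n, theta n.+1 <= theta n) ->
  (forall e : R, 0 < e -> exists N, forall n, (N <= n)%N -> theta n < e) ->
  olt OZ xi ->
  (forall n, olt OZ (beta n) /\ olt (beta n) (oexp xi)) ->
  oeq (OL beta) (oexp xi) ->
  fund_seq fs -> schreier_system fs S ->
  ~ dagger theta beta xi ->
  index_is theta (fun n => S (beta n)) (oexp (oexp xi)) /\
  ~ (exists x : nat -> nat -> R,
       l1_spreading theta (fun n => S (beta n)) (S (oexp xi)) x).
Proof.
move=> theta01 theta_mono theta_null xi0 _ beta_sup Hfs HS Hdag.
have upper := l1tree_bounded theta01 theta_mono theta_null xi0 Hfs HS Hdag.
have index K : 0 < K -> exists c, indexK_is theta (fun n => S (beta n)) K c /\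
    ole c (oexp (oexp xi)).
  move=> K0; have [c Hc cmin] := @ord_least (fun c => tree_empty (dtree (l1tree theta _ K) c)) _ (upper K K0); exists c; split; first by split.
  by case: (ole_or_olt c (oexp (oexp xi))) => // /cmin; case; exact: upper.
split; [split=> [K K1|b Hb]|move=> [x Hx]].
- by apply: index; exact: lt_le_trans K1.
(* [omega^(omega^xi)] is the supremum of the [omega^(beta n)]; the unit vectors with constant
   [1 / theta n] then give an index above [b]. *)
- have [n Hn] : exists n, olt b (oexp (beta n)).
    by apply: olt_lim_inv; exact: olt_ole_trans Hb (oexp_le beta_sup.2).
  case/andP: (theta01 n) => t0 t1.
  have K0 : 0 < (theta n)^-1 by rewrite invr_gt0.
  exists (theta n)^-1; split; first by rewrite invf_ge1 // ltW.
  have [c [Hc _]] := index _ K0; exists c; split=> //.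
  case: (ole_or_olt c b) => // cb; case: Hc => /(_ [::]) []; apply: dtree_le cb _.
  apply: dtree_le (olt_le Hn) _.
  apply: (schreier_rank Hfs HS (x := @unit_vec R) (N := 0%N)) => F SF _.
  exact: (l1tree_unit_vec theta01 Hfs HS).
(* A spreading model would keep the empty node in the derived tree of order [omega^(omega^xi)],
   which [upper] shows to be empty. *)
- have [K K0 HK] := l1tree_spreading Hx (fun F => @S_fin _ _ Hfs HS _ F).
  apply: (upper K K0 [::]).
  by apply: (schreier_rank Hfs HS (x := x) (N := 0%N)) => F SF _; exact: HK.
Qed.
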